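(* Let $\kappa,c\in\mathbb{R}$ with $c\neq0$. On the configuration space, with local coordinates $(\theta,\phi,h,q,\psi)$, $h>0$, $h^2\neq\kappa c^2$, of an An-Nurowski surface rolling without slipping or twisting over the plane, consider the vector fields associated to the corresponding $(2,3,5)$-distribution $$S^1=\frac{\kappa c^2-h^2}{2c^3}\partial_\phi+\cos(\psi)\Big(\frac{\kappa c^2-h^2}{2c^3h}\partial_q-\frac1h\partial_\psi\Big)-\sin(\psi)\partial_h,$$ $$S^2=\frac{\kappa c^2-h^2}{2c^3}\partial_\theta+\sin(\psi)\Big(\frac{\kappa c^2-h^2}{2c^3h}\partial_q-\frac1h\partial_\psi\Big)+\cos(\psi)\partial_h,$$ $$\begin{aligned} S^3={}&3(h^2-\kappa c^2)(\theta\partial_\phi-\phi\partial_\theta)-4c^2h(\kappa\psi+2cq)\partial_h-(3\kappa c^2-h^2)\partial_\psi\\ &-\frac{1}{2c^3}\Big(c^4(2cq+\kappa\psi)^2-(3\kappa c^2-h^2)(\kappa c^2-h^2)\Big)\partial_q\\ &+\cos(\psi)\Big(6c^3\phi\,\partial_h+\frac3h(h^2-\kappa c^2)\theta\,\partial_q+\frac{6c^3\theta}{h}\partial_\psi-\frac{2h}{c}(\kappa c^2-h^2)(2cq+\kappa\psi)\partial_\theta\\ &\qquad-\frac{h}{2c^3}\big(2c^4(2cq+\kappa\psi)^2-(3\kappa c^2-h^2)(\kappa c^2-h^2)\big)\partial_\phi\Big)\\ &-\sin(\psi)\Big(-6c^3\theta\,\partial_h+\frac3h(h^2-\kappa c^2)\phi\,\partial_q+\frac{6c^3\phi}{h}\partial_\psi-\frac{2h}{c}(\kappa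 c^2-h^2)(2cq+\kappa\psi)\partial_\phi\\ &\qquad+\frac{h}{2c^3}\big(2c^4(2cq+\kappa\psi)^2-(3\kappa c^2-h^2)(\kappa c^2-h^2)\big)\partial_\theta\Big). \end{aligned}$$ Then $S^1,S^2,S^3$ pairwise bracket-generate the Lie algebra of split $\mathfrak{g}_2$.
   Context: The An-Nurowski surface is the surface with coordinates $(h,q)$ and metric $\left(\frac{\kappa c^2-h^2}{2c^3}\right)^2dh^2+h^2dq^2$; the plane has metric $d\theta^2+d\phi^2$; $\psi$ is the angular fibre coordinate. The $(2,3,5)$-distribution of the rolling is the rank 2 distribution annihilated by $$\omega_1=d\theta-\cos(\psi)\tfrac{\kappa c^2-h^2}{2c^3}dh-\sin(\psi)h\,dq,\quad \omega_2=d\phi+\sin(\psi)\tfrac{\kappa c^2-h^2}{2c^3}dh-\cos(\psi)h\,dq,\quad \omega_3=d\psi+\tfrac{2c^3}{\kappa c^2-h^2}dq,$$ and $S^1,S^2$ are sections of it. ''Pairwise bracket-generate the Lie algebra of split $\mathfrak{g}_2$'' means the following. Define, using Lie brackets of vector fields, $$S^4=[S^1,S^2],\quad S^5=[S^2,S^3],\quad S^6=[S^3,S^1],$$ $$L^1=[S^1,S^4],\quad L^3=[S^2,S^5],\quad L^5=[S^3,S^6],\quad L^2=[S^2,S^4],\quad L^4=[S^3,S^5],\quad L^6=[S^1,S^6],$$ $$H_1=[S^2,S^6],\quad H_2=[S^4,S^3].$$ Then the 14 vector fields $$S^1,\dots,S^6,\ \tfrac14(H_2-H_1),\ \tfrac{\sqrt3}{12}(H_1+H_2),\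 L^1,\dots,L^6$$ form (i.e. are a basis over $\mathbb{R}$ of) a 14-dimensional Lie algebra of vector fields isomorphic to the split real form of the exceptional simple Lie algebra $\mathfrak{g}_2$, with Cartan subalgebra spanned by $\tfrac14(H_2-H_1)$ and $\tfrac{\sqrt3}{12}(H_1+H_2)$. *)

(* Defs.v *)
From mathcomp Require Import all_boot all_order all_algebra.
From mathcomp Require Import all_classical all_reals all_analysis.

Set Implicit Arguments.
Unset Strict Implicit.
Unset Printing Implicit Defensive.

Import Order.TTheory GRing.Theory Num.Theory.
Import numFieldNormedType.Exports.

Local Open Scope classical_set_scope.
Local Open Scope ring_scope.

(** * Lie algebras

A Lie algebra is a subset [L] of a real vector space [V] with a bracket [br]
that is only required to behave well on [L]: the bracket of vector fields is a
total function, but it is meaningful on differentiable fields only. *)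

Definition lspan (R : realType) (V : lmodType R) (s : seq V) : set V :=
  [set x | exists a : 'I_(size s) -> R, x = \sum_i a i *: s`_i].

Definition lin_indep (R : realType) (V : lmodType R) (s : seq V) : Prop :=
  forall a : 'I_(size s) -> R, \sum_i a i *: s`_i = 0 -> forall i, a i = 0.

Definition is_lie_algebra (R : realType) (V : lmodType R)
    (br : V -> V -> V) (L : set V) : Prop :=
  [/\ L 0 /\ (forall (a : R) x y, L x -> L y -> L (a *: x + y)),
      forall x y, L x -> L y -> L (br x y),
      forall (a : R) x y z, L x -> L y -> L z ->
        br (a *: x + y) z = a *: br x z + br y z /\
        br z (a *: x + y) = a *: br z x + br z y,
      forall x, L x -> br x x = 0
    & forall x y z, L x -> L y -> L z ->
        br x (br y z) + br y (br z x) + br z (br x y) = 0].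

Definition lie_isomorphic (R : realType) (V W : lmodType R)
    (brV : V -> V -> V) (L : set V) (brW : W -> W -> W) (M : set W) : Prop :=
  exists f : V -> W,
    [/\ set_bij L M f,
        forall (a : R) x y, L x -> L y -> f (a *: x + y) = a *: f x + f y
      & forall x y, L x -> L y -> f (brV x y) = brW (f x) (f y)].

(* The lower central series of [H] is spanned by the left-normed brackets
   [[..[[x, y1], y2], ..], yn] (here a [foldl]). *)
Definition lie_nilpotent (R : realType) (V : lmodType R)
    (br : V -> V -> V) (H : set V) : Prop :=
  exists n : nat, forall (x : V) (s : seq V), H x ->
    (forall i, (i < size s)%N -> H s`_i) -> size s = n -> foldl br x s = 0.

(* A nilpotent subalgebra equal to its own normalizer. *)
Definition cartan_subalgebra (R : realType) (V : lmodType R)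
    (br : V -> V -> V) (L H : set V) : Prop :=
  [/\ H `<=` L, is_lie_algebra br H, lie_nilpotent br H
    & forall x, L x -> (forall y, H y -> H (br x y)) -> H x].

(** * The split real form of g2: derivations of the split octonions *)

(* Cayley-Dickson double of the split quaternions 'M[R]_2, whose conjugation
   is the adjugate. *)
Notation split_octonion R := ('M[R]_2 * 'M[R]_2)%type.

Definition omul (R : realType) (x y : split_octonion R) : split_octonion R :=
  (x.1 *m y.1 + \adj y.2 *m x.2, y.2 *m x.1 + x.2 *m \adj y.1).

Definition split_g2 (R : realType) : set 'End(split_octonion R) :=
  [set D | forall x y : split_octonion R,
             D (omul x y) = omul (D x) y + omul x (D y)].

Definition commutator (R : realType) (U : vectType R) (f g : 'End(U)) :
  'End(U) := (f \o g)%VF - (g \o f)%VF.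

(** * Vector fields on an open subset U of R^5

A vector field on [U] is represented by its extension by zero to R^5, so that
equality of vector fields on [U] is equality of functions. *)

Definition extend0 (R : realType) (U : set 'rV[R]_5)
    (X : 'rV[R]_5 -> 'rV[R]_5) : 'rV[R]_5 -> 'rV[R]_5 := patch (fun=> 0) U X.

Fixpoint Cn_on (R : realType) (n : nat) (U : set 'rV[R]_5)
    (X : 'rV[R]_5 -> 'rV[R]_5) : Prop :=
  match n with
  | 0%N => forall p, U p -> {for p, continuous X}
  | m.+1 => (forall p, U p -> differentiable X p) /\
            (forall v, Cn_on m U (fun p => 'D_v X p))
  end.

Definition vector_fields (R : realType) (U : set 'rV[R]_5) :
    set ('rV[R]_5 -> 'rV[R]_5) :=
  [set X | (forall p, ~ U p -> X p = 0) /\ (forall n, Cn_on n U X)].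

(* If [X] and [Y] vanish outside [U], so does their bracket. *)
Definition vbracket (R : realType) (X Y : 'rV[R]_5 -> 'rV[R]_5) :
    'rV[R]_5 -> 'rV[R]_5 :=
  fun p => 'D_(X p) Y p - 'D_(Y p) X p.

Definition pairwise_bracket_generate_split_g2 (R : realType)
    (U : set 'rV[R]_5) (S1 S2 S3 : 'rV[R]_5 -> 'rV[R]_5) : Prop :=
  let S4 := vbracket S1 S2 in
  let S5 := vbracket S2 S3 in
  let S6 := vbracket S3 S1 in
  let L1 := vbracket S1 S4 in
  let L3 := vbracket S2 S5 in
  let L5 := vbracket S3 S6 in
  let L2 := vbracket S2 S4 in
  let L4 := vbracket S3 S5 in
  let L6 := vbracket S1 S6 in
  let H1 := vbracket S2 S6 in
  let H2 := vbracket S4 S3 in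
  let T1 := 4^-1 *: (H2 - H1) in
  let T2 := (Num.sqrt 3 / 12) *: (H1 + H2) in
  let B := [:: S1; S2; S3; S4; S5; S6; T1; T2; L1; L2; L3; L4; L5; L6] in
  let L := lspan B in
  [/\ lin_indep B,
      L `<=` vector_fields U,
      is_lie_algebra (@vbracket R) L,
      lie_isomorphic (@vbracket R) L (@commutator R _) (@split_g2 R)
    & cartan_subalgebra (@vbracket R) L (lspan [:: T1; T2])].

(** * Rolling the An-Nurowski surface over the plane

Points of R^5 are (theta, phi, h, q, psi), in this order; the surface metric is
[gfac kappa c h ^+ 2 dh^2 + h ^+ 2 dq^2]. *)

Section Rolling.
Context {R : realType}.
Implicit Types (kappa c : R) (p v : 'rV[R]_5).

Definition theta_ p : R := p 0 0.
Definition phi_ p : R := p 0 1.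
Definition h_ p : R := p 0 2.
Definition q_ p : R := p 0 3.
Definition psi_ p : R := p 0 4.

Definition d_theta : 'rV[R]_5 := delta_mx 0 0.
Definition d_phi : 'rV[R]_5 := delta_mx 0 1.
Definition d_h : 'rV[R]_5 := delta_mx 0 2.
Definition d_q : 'rV[R]_5 := delta_mx 0 3.
Definition d_psi : 'rV[R]_5 := delta_mx 0 4.

Definition conf_space kappa c : set 'rV[R]_5 :=
  [set p | 0 < h_ p /\ h_ p ^+ 2 != kappa * c ^+ 2].

Definition gfac kappa c (h : R) : R :=
  (kappa * c ^+ 2 - h ^+ 2) / (2 * c ^+ 3).

Definition omega1 kappa c p v : R :=
  theta_ v - cos (psi_ p) * gfac kappa c (h_ p) * h_ v
           - sin (psi_ p) * h_ p * q_ v.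

Definition omega2 kappa c p v : R :=
  phi_ v + sin (psi_ p) * gfac kappa c (h_ p) * h_ v
         - cos (psi_ p) * h_ p * q_ v.

Definition omega3 kappa c p v : R :=
  psi_ v + 2 * c ^+ 3 / (kappa * c ^+ 2 - h_ p ^+ 2) * q_ v.

Definition rolling_distribution kappa c p : set 'rV[R]_5 :=
  [set v | [/\ omega1 kappa c p v = 0, omega2 kappa c p v = 0
             & omega3 kappa c p v = 0]].

Definition S1_field kappa c p : 'rV[R]_5 :=
  let h := h_ p in let psi := psi_ p in
  ((kappa * c ^+ 2 - h ^+ 2) / (2 * c ^+ 3)) *: d_phi
  + cos psi *: (((kappa * c ^+ 2 - h ^+ 2) / (2 * c ^+ 3 * h)) *: d_q
                - h^-1 *: d_psi)
  - sin psi *: d_h.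

Definition S2_field kappa c p : 'rV[R]_5 :=
  let h := h_ p in let psi := psi_ p in
  ((kappa * c ^+ 2 - h ^+ 2) / (2 * c ^+ 3)) *: d_theta
  + sin psi *: (((kappa * c ^+ 2 - h ^+ 2) / (2 * c ^+ 3 * h)) *: d_q
                - h^-1 *: d_psi)
  + cos psi *: d_h.

Definition S3_field kappa c p : 'rV[R]_5 :=
  let theta := theta_ p in let phi := phi_ p in let h := h_ p in
  let q := q_ p in let psi := psi_ p in
  (3 * (h ^+ 2 - kappa * c ^+ 2)) *: (theta *: d_phi - phi *: d_theta)
  - (4 * c ^+ 2 * h * (kappa * psi + 2 * c * q)) *: d_h
  - (3 * kappa * c ^+ 2 - h ^+ 2) *: d_psi
  - ((2 * c ^+ 3)^-1 *
     (c ^+ 4 * (2 * c * q + kappa * psi) ^+ 2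
      - (3 * kappa * c ^+ 2 - h ^+ 2) * (kappa * c ^+ 2 - h ^+ 2))) *: d_q
  + cos psi *:
    ((6 * c ^+ 3 * phi) *: d_h
     + (3 / h * (h ^+ 2 - kappa * c ^+ 2) * theta) *: d_q
     + (6 * c ^+ 3 * theta / h) *: d_psi
     - (2 * h / c * (kappa * c ^+ 2 - h ^+ 2) * (2 * c * q + kappa * psi))
         *: d_theta
     - (h / (2 * c ^+ 3) *
        (2 * c ^+ 4 * (2 * c * q + kappa * psi) ^+ 2
         - (3 * kappa * c ^+ 2 - h ^+ 2) * (kappa * c ^+ 2 - h ^+ 2)))
         *: d_phi)
  - sin psi *:
    (- (6 * c ^+ 3 * theta) *: d_h
     + (3 / h * (h ^+ 2 - kappa * c ^+ 2) * phi) *: d_q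
     + (6 * c ^+ 3 * phi / h) *: d_psi
     - (2 * h / c * (kappa * c ^+ 2 - h ^+ 2) * (2 * c * q + kappa * psi))
         *: d_phi
     + (h / (2 * c ^+ 3) *
        (2 * c ^+ 4 * (2 * c * q + kappa * psi) ^+ 2
         - (3 * kappa * c ^+ 2 - h ^+ 2) * (kappa * c ^+ 2 - h ^+ 2)))
         *: d_theta).

End Rolling.

(* Main.v *)
(** Put [x = h cos psi], [y = h sin psi], [u = - 2 c^3 theta + kappa c^2 x],
    [v = - 2 c^3 phi - kappa c^2 y] and [w = - c^2 (2 c q + kappa psi)].  In the
    coordinates [(u, v, x, y, w)] neither [kappa] nor [c] is left:
    [S1 = r2 d_v - d_y + x d_w], [S2 = r2 d_u + d_x + y d_w] with
    [r2 = x^2 + y^2], and [S3] is a polynomial field with integer coefficients.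
    The structure constants of the fourteen fields are therefore integers, and
    they coincide with those of fourteen derivations of the split octonions,
    given by integer 8x8 matrices and obtained by the same bracket recipe from
    three of them.  Both families are linearly independent, because their linear
    relations form an ideal: bracketing a relation with suitable basis elements
    isolates any chosen coefficient.  The derivations span the derivation algebra,
    because the Leibniz identities on basis products force a derivation with
    fourteen vanishing entries to be [0].  The Jacobi identity for the fields is
    transported from the commutators of derivations. *)

Require Import Defs.
From HB Require Import structures.
From Stdlib Require Import ZArith BinList Ring_theory Ring_polynom InitialRing.
From mathcomp Require Import all_boot all_order all_algebra.
From mathcomp Require Import all_classical all_reals all_analysis.
From mathcomp Require Import ssrZ ring lra.

Set Implicit Arguments.
Unset Strict Implicit.
Unset Printing Implicit Defensive.

Import Order.TTheory GRing.Theory Num.Theory.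
Import numFieldNormedType.Exports.

Local Open Scope classical_set_scope.
Local Open Scope ring_scope.

(** * Binary integers as scalars, and integer matrices on which finite checks are computed *)

Definition zr {R : pzRingType} (z : Z) : R := (int_of_Z z)%:~R.

Lemma zr_is_zmod_morphism (R : pzRingType) : zmod_morphism (@zr R).
Proof. by move=> x y; rewrite /zr !raddfB. Qed.

Lemma zr_is_monoid_morphism (R : pzRingType) : monoid_morphism (@zr R).
Proof. by split=> [|x y]; rewrite /zr ?rmorph1 // !rmorphM. Qed.

HB.instance Definition _ (R : pzRingType) :=
  GRing.isZmodMorphism.Build Z R zr (@zr_is_zmod_morphism R).
HB.instance Definition _ (R : pzRingType) :=
  GRing.isMonoidMorphism.Build Z R zr (@zr_is_monoid_morphism R).

(** Characteristic zero lets the nonvanishing of computed integers pass to real scalars. *)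
Lemma zr_eq0 (R : numDomainType) (z : Z) : (zr z == 0 :> R) = (z == 0).
Proof.
rewrite /zr intr_eq0; apply/eqP/eqP => [z0|-> //].
by rewrite -[z]int_of_ZK z0.
Qed.

(** A fold, so that it evaluates inside the computed checks; [zr_sum] relates it to big sums. *)
Definition zsum (n : nat) (f : nat -> Z) : Z :=
  foldr (fun k s => f k + s) 0 (iota 0 n).

Lemma zr_sum (R : pzRingType) n (f : nat -> Z) :
  zr (zsum n f) = \sum_(k < n) zr (f k) :> R.
Proof.
rewrite -(big_mkord xpredT (fun k => zr (f k))) /index_iota subn0 /zsum.
elim: (iota 0 n) => [|k s IH]; first by rewrite big_nil /= raddf0.
by rewrite big_cons /= -IH -raddfD.
Qed.

Definition zent (M : seq (seq Z)) (i j : nat) : Z := nth 0 (nth [::] M i) j.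

Definition zmat (m n : nat) (f : nat -> nat -> Z) : seq (seq Z) :=
  [seq [seq f i j | j <- iota 0 n] | i <- iota 0 m].

Lemma zentE m n f i j : (i < m)%N -> (j < n)%N -> zent (zmat m n f) i j = f i j.
Proof.
move=> im jn; rewrite /zent /zmat (nth_map 0%N) ?size_iota //.
by rewrite (nth_map 0%N) ?size_iota // !nth_iota.
Qed.

(** * Structure constants of g2 *)

(* In the order [S1 .. S6, H1, H2, L1 .. L6], numbered from 0. *)
Definition g2_gens (T : Type) (br : T -> T -> T) (s1 s2 s3 : T) : seq T :=
  let s4 := br s1 s2 in let s5 := br s2 s3 in let s6 := br s3 s1 in
  [:: s1; s2; s3; s4; s5; s6; br s2 s6; br s4 s3;
      br s1 s4; br s2 s4; br s2 s5; br s3 s5; br s3 s6; br s1 s6].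

(* In the basis [e11, e12, e21, e22] of each of the two copies of ['M_2]; the
   entries at [pos] are [1], those at [neg] are [-1]. *)
Definition der_gen (pos neg : seq (nat * nat)) : seq (seq Z) :=
  zmat 8 8 (fun i j => ((i, j) \in pos)%:R - ((i, j) \in neg)%:R).

Definition der1 :=
  der_gen [:: (0, 7); (2, 6); (4, 3); (5, 1)]%N [:: (3, 7); (4, 0)]%N.
Definition der2 :=
  der_gen [:: (3, 5); (6, 3); (7, 1)]%N [:: (0, 5); (2, 4); (6, 0)]%N.
Definition der3 :=
  der_gen [:: (1, 0); (3, 2); (5, 4); (7, 6)]%N [:: (0, 2); (1, 3)]%N.

Definition zcomm (M N : seq (seq Z)) : seq (seq Z) :=
  zmat 8 8 (fun i j =>
    zsum 8 (fun k => zent M i k * zent N k j - zent N i k * zent M k j)).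

Definition der_basis := Eval vm_compute in g2_gens zcomm der1 der2 der3.

(* Coordinates in [der_basis]: each root derivation is recognised on one of its
   nonzero entries.  On integer combinations of [der_basis] the divisions are
   exact. *)
Definition der_coord (M : seq (seq Z)) : seq Z :=
  let m (i j : nat) : Z := zent M i j in
  [:: m 5 1; m 7 1; m 7 6; Z.div (m 6 7) 2; Z.div (m 7 0) 2; Z.div (m 5 3) 2;
      Z.div (m 6 6 + m 7 7) 6; Z.div (m 6 6 - 2 * m 7 7) 6;
      Z.div (m 2 7) 6; - Z.div (m 6 1) 6; Z.div (m 7 5) 6; Z.div (m 7 2) 6;
      - Z.div (m 5 2) 6; Z.div (m 5 7) 6]%N%R.

(** The rows come from reading off coordinates with [der_coord]; that they are the structure
    constants is certified by [der_table_check]. *)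
Definition g2_table := Eval vm_compute in
  [seq [seq der_coord (zcomm M N) | N <- der_basis] | M <- der_basis].

Definition g2_const (i j k : nat) : Z :=
  nth 0 (nth [::] (nth [::] g2_table i) j) k.

Definition has_g2_brackets (R : realType) (V : lmodType R) (br : V -> V -> V)
    (b : seq V) : Prop :=
  forall i j, (i < 14)%N -> (j < 14)%N ->
    br b`_i b`_j = \sum_(k < 14) zr (g2_const i j k) *: b`_k.

Definition zad (i : nat) (v : seq Z) : seq Z :=
  [seq zsum 14 (fun j => nth 0 v j * g2_const i j k) | k <- iota 0 14].

Definition zunit (j : nat) : seq Z :=
  [seq (k == j)%:R | k <- iota 0 14].

(* Brackets leading from the [j]-th basis vector to the long root vector [L4],
   then twice with the opposite root vector [L1]: the square of [ad L1] maps [L4]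
   to a multiple of [L1] and kills the other basis vectors. *)
Definition ad_path (j : nat) : seq nat :=
  nth [::] [:: [:: 4; 11]; [:: 2; 2]; [:: 4]; [:: 2; 11]; [:: 2]; [:: 2; 10];
    [:: 10; 12]; [:: 11]; [:: 11; 11]; [:: 11; 12]; [:: 12]; [::];
    [:: 10]; [:: 10; 11]]%N j ++ [:: 8; 8]%N.

Definition zad_path (s : seq nat) (v : seq Z) : seq Z :=
  foldl (fun w i => zad i w) v s.

(** The path of [j] sends the [j]-th basis vector to a nonzero multiple of [L1] (index 8) and every
    other basis vector to 0. *)
Lemma zad_path_check :
  all (fun j => all (fun j' => all (fun k =>
      (nth 0 (zad_path (ad_path j) (zunit j')) k == 0)
        == ~~ ((k == 8) && (j' == j)))
    (iota 0 14)) (iota 0 14)) (iota 0 14).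
Proof. by vm_compute. Qed.

(** Root space decomposition: every basis vector is a weight vector for [H1] and [H2] (indices 6 and
    7), with nonzero weight except for [H1] and [H2] themselves. *)
Lemma weight_check :
  all (fun i => all (fun k => (k == i) ||
      ((g2_const i 6 k == 0) && (g2_const i 7 k == 0))) (iota 0 14) &&
    ((g2_const i 6 i != 0) || (g2_const i 7 i != 0) || (i == 6) || (i == 7)))
    (iota 0 14).
Proof. by vm_compute. Qed.

(** * Spans and brackets *)

Section Span.
Context {R : realType} {V : lmodType R}.
Implicit Types (s : seq V) (L : set V).

(** Coefficients indexed by [nat] avoid casts between ordinals of [size s] and of the known
    length. *)
Lemma lspanP s n x : size s = n ->
  lspan s x <-> exists a : nat -> R, x = \sum_(i < n) a i *: s`_i.
Proof.
move=> <-; split=> [[a ->]|[a ->]]; last by exists (fun i => a i).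
exists (fun k => if insub k is Some i then a i else 0).
by apply: eq_bigr => i _; rewrite valK.
Qed.

Lemma lin_indepP s n : size s = n ->
  (forall a : nat -> R, \sum_(i < n) a i *: s`_i = 0 ->
     forall i, (i < n)%N -> a i = 0) -> lin_indep s.
Proof.
move=> <- ind a a0 i.
have := ind (fun k => if insub k is Some i then a i else 0) _ i (ltn_ord i).
rewrite valK; apply; rewrite -[RHS]a0.
by apply: eq_bigr => j _; rewrite valK.
Qed.

Lemma lin_indepE s n (a : nat -> R) : size s = n -> lin_indep s ->
  \sum_(i < n) a i *: s`_i = 0 -> forall i, (i < n)%N -> a i = 0.
Proof. by move=> <- ind a0 i ilt; exact: (ind (fun k => a k) a0 (Ordinal ilt)). Qed.

Definition lin_closed L :=
  L 0 /\ (forall (a : R) x y, L x -> L y -> L (a *: x + y)).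

Lemma lspan_closed s : lin_closed (lspan s).
Proof.
split=> [|a x y [u ->] [v ->]].
  by exists (fun=> 0); rewrite big1 // => i _; rewrite scale0r.
exists (fun i => a * u i + v i); rewrite scaler_sumr -big_split /=.
by apply: eq_bigr => i _; rewrite scalerDl scalerA.
Qed.

Lemma closed_sum L n (a : nat -> R) (x : nat -> V) : lin_closed L ->
  (forall i, (i < n)%N -> L (x i)) -> L (\sum_(i < n) a i *: x i).
Proof.
move=> [L0 LD]; elim: n => [|n IH] Lx; first by rewrite big_ord0.
rewrite big_ord_recr /= addrC; apply: LD; first exact: Lx.
by apply: IH => i ilt; apply: Lx; rewrite ltnW.
Qed.

Lemma lspan_sub s L n : size s = n -> lin_closed L ->
  (forall i, (i < n)%N -> L s`_i) -> lspan s `<=` L.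
Proof. by move=> sn Lc Ls x /(lspanP _ sn)[a ->]; exact: (closed_sum a Lc Ls). Qed.

Lemma lspan_nth s i : (i < size s)%N -> lspan s s`_i.
Proof.
move=> ilt; exists (fun k => (k == Ordinal ilt)%:R).
rewrite (bigD1 (Ordinal ilt)) //= eqxx scale1r big1 ?addr0 //.
by move=> k /negPf ->; rewrite scale0r.
Qed.

(** Bilinearity is relative to [L] because the bracket of vector fields is bilinear only on
    differentiable fields. *)
Definition bilinear_on (br : V -> V -> V) L :=
  forall (a : R) x y z, L x -> L y -> L z ->
    br (a *: x + y) z = a *: br x z + br y z /\
    br z (a *: x + y) = a *: br z x + br z y.

Variables (br : V -> V -> V) (L : set V).
Hypotheses (Lc : lin_closed L) (Lbil : bilinear_on br L).

Lemma br0l z : L z -> br 0 z = 0.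
Proof.
move=> Lz; have [+ _] := Lbil 1 Lc.1 Lc.1 Lz.
by rewrite !scale1r addr0 => /esym/eqP; rewrite -subr_eq0 addrK => /eqP.
Qed.

Lemma br0r z : L z -> br z 0 = 0.
Proof.
move=> Lz; have [_ +] := Lbil 1 Lc.1 Lc.1 Lz.
by rewrite !scale1r addr0 => /esym/eqP; rewrite -subr_eq0 addrK => /eqP.
Qed.

Lemma br_suml n (a : nat -> R) (x : nat -> V) z :
  (forall i, (i < n)%N -> L (x i)) -> L z ->
  br (\sum_(i < n) a i *: x i) z = \sum_(i < n) a i *: br (x i) z.
Proof.
move=> Lx Lz; elim: n Lx => [|n IH] Lx; first by rewrite !big_ord0 br0l.
have Lx' i : (i < n)%N -> L (x i) by move=> ilt; apply: Lx; rewrite ltnW.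
rewrite !big_ord_recr /= addrC; have [-> _] := Lbil (a n) (Lx n (ltnSn n))
  (closed_sum a Lc Lx') Lz.
by rewrite IH // addrC.
Qed.

Lemma br_sumr n (a : nat -> R) (x : nat -> V) z :
  (forall i, (i < n)%N -> L (x i)) -> L z ->
  br z (\sum_(i < n) a i *: x i) = \sum_(i < n) a i *: br z (x i).
Proof.
move=> Lx Lz; elim: n Lx => [|n IH] Lx; first by rewrite !big_ord0 br0r.
have Lx' i : (i < n)%N -> L (x i) by move=> ilt; apply: Lx; rewrite ltnW.
rewrite !big_ord_recr /= addrC; have [_ ->] := Lbil (a n) (Lx n (ltnSn n))
  (closed_sum a Lc Lx') Lz.
by rewrite IH // addrC.
Qed.

End Span.

(** * Consequences of the structure constants: closure, independence, Cartan subalgebra *)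

Section G2Basis.
Context {R : realType} {V : lmodType R}.
Variables (br : V -> V -> V) (b : seq V).
Hypotheses (bsz : size b = 14%N) (bil : bilinear_on br (lspan b)).
Hypothesis tab : has_g2_brackets br b.

Let Lc : lin_closed (lspan b) := lspan_closed b.
Let Lb i : (i < 14)%N -> lspan b b`_i.
Proof. by rewrite -bsz; exact: lspan_nth. Qed.

Lemma g2_lspan_br x y : lspan b x -> lspan b y -> lspan b (br x y).
Proof.
move=> /(lspanP _ bsz)[u ->] Ly.
rewrite (br_suml Lc bil) //.
apply: (closed_sum u (x := fun i => br b`_i y) Lc) => i ilt.
have /(lspanP _ bsz)[v ->] := Ly.
rewrite (br_sumr Lc bil) //; last exact: Lb.
apply: (closed_sum v (x := fun j => br b`_i b`_j) Lc) => j jlt; rewrite tab //.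
exact: (closed_sum (fun k => zr (g2_const i j k)) (x := nth 0 b) Lc).
Qed.

Let sem (v : seq Z) : V := \sum_(k < 14) zr (nth 0 v k) *: b`_k.

Let Lsem v : lspan b (sem v).
Proof. exact: (closed_sum (fun k => zr (nth 0 v k)) (x := nth 0 b) Lc). Qed.

Let br_sem i v : (i < 14)%N -> br b`_i (sem v) = sem (zad i v).
Proof.
move=> ilt; rewrite /sem (br_sumr Lc bil (fun k => zr (nth 0 v k)) (x := nth 0 b)) //;
  last exact: Lb.
under eq_bigr => j _ do rewrite tab // scaler_sumr.
rewrite exchange_big /=; apply: eq_bigr => k _.
rewrite (nth_map 0%N) ?size_iota // nth_iota // zr_sum scaler_suml.
by apply: eq_bigr => j _; rewrite scalerA -rmorphM.
Qed.

Let sem_unit j : (j < 14)%N -> sem (zunit j) = b`_j.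
Proof.
move=> jlt; rewrite /sem (bigD1 (Ordinal jlt)) //= big1 ?addr0 => [|k].
  by rewrite (nth_map 0%N) ?size_iota // nth_iota // eqxx rmorph1 scale1r.
rewrite -val_eqE /= => kj; rewrite (nth_map 0%N) ?size_iota // nth_iota //.
by rewrite add0n (negPf kj) raddf0 scale0r.
Qed.

(** Linear relations form an ideal: a relation stays a relation after bracketing all its terms with
    the same basis vectors. *)
Let path_sem s (a : nat -> R) (v : nat -> seq Z) :
  all (gtn 14) s -> \sum_(j < 14) a j *: sem (v j) = 0 ->
  \sum_(j < 14) a j *: sem (zad_path s (v j)) = 0.
Proof.
elim: s v => [|i s IH] v //= /andP[ilt slt] v0.
apply: (IH (fun j => zad i (v j))) => //.
transitivity (br b`_i (\sum_(j < 14) a j *: sem (v j))).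
  rewrite (br_sumr Lc bil a (x := fun j => sem (v j))) //; last exact: Lb.
  by apply: eq_bigr => j _; rewrite br_sem.
by rewrite v0 (br0r Lc bil) //; apply: Lb.
Qed.

(** Along [ad_path j] a relation collapses to [a j] times a nonzero integer multiple of the vector
    of index 8, so the nonvanishing of that vector gives [a j = 0]. *)
Lemma g2_lin_indep : b`_8 != 0 -> lin_indep b.
Proof.
move=> b8; apply: (lin_indepP bsz) => a a0 j jlt.
have pth : all (gtn 14) (ad_path j).
  by do 14?[case: j jlt => [|j] jlt //].
have := path_sem (a := a) (v := zunit) pth.
have -> : \sum_(k < 14) a k *: sem (zunit k) = 0.
  by rewrite -[RHS]a0; apply: eq_bigr => k _; rewrite sem_unit.
move=> /(_ erefl).
have chk k j' : (k < 14)%N -> (j' < 14)%N ->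
    (nth 0 (zad_path (ad_path j) (zunit j')) k == 0)
      = ~~ ((k == 8) && (j' == j))%N.
  move=> klt j'lt; have /allP/(_ j) := zad_path_check.
  rewrite mem_iota => /(_ jlt)/allP/(_ j'); rewrite mem_iota.
  by move=> /(_ j'lt)/allP/(_ k); rewrite mem_iota => /(_ klt)/eqP.
rewrite (bigD1 (Ordinal jlt)) //= big1 ?addr0 => [|j']; last first.
  rewrite -val_eqE /= => /negPf j'j; rewrite /sem big1 ?scaler0 // => k _.
  have := chk k j' (ltn_ord k) (ltn_ord j').
  by rewrite j'j andbF => /eqP ->; rewrite raddf0 scale0r.
rewrite /sem (bigD1 (Ordinal (isT : 8 < 14)%N)) //= big1 ?addr0 => [|k]; last first.
  rewrite -val_eqE /= => /negPf k8; have := chk k j (ltn_ord k) jlt.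
  by rewrite k8 => /eqP ->; rewrite raddf0 scale0r.
have := chk 8%N j isT jlt; rewrite !eqxx /= => z0.
move/eqP; rewrite scalerA scaler_eq0 (negPf b8) orbF mulf_eq0 zr_eq0 z0 orbF.
by move/eqP.
Qed.

Hypothesis ind : lin_indep b.

(** Bracketing with [H1] or [H2] is diagonal in the basis, by [weight_check]. *)
Lemma g2_cartan_br (x : V) (j : nat) (a : nat -> R) : j = 6%N \/ j = 7%N ->
  x = \sum_(i < 14) a i *: b`_i ->
  br x b`_j = \sum_(i < 14) (a i * zr (g2_const i j i)) *: b`_i.
Proof.
move=> j67 ->; have jlt : (j < 14)%N by case: j67 => ->.
rewrite (br_suml Lc bil) //; last exact: Lb.
apply: eq_bigr => i _; rewrite tab // -scalerA; congr (_ *: _).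
rewrite (bigD1 i) //= big1 ?addr0 // => k; rewrite -val_eqE => /negPf ki.
have /allP/(_ i) := weight_check; rewrite mem_iota => /(_ (ltn_ord i)).
move=> /andP[/allP/(_ k) + _]; rewrite mem_iota => /(_ (ltn_ord k)).
rewrite ki /= => /andP[c6 c7].
by case: j67 => ->; [rewrite (eqP c6)|rewrite (eqP c7)]; rewrite raddf0 scale0r.
Qed.

Let pair_lt i : (i < 2)%N -> (i + 6 < 14)%N.
Proof. by case: i => [|[|]]. Qed.

Let cartan_nth i : (i < 2)%N -> [:: b`_6; b`_7]`_i = b`_(i + 6).
Proof. by case: i => [|[|]]. Qed.

(** The span of [H1] and [H2] is abelian. An element normalizing it has no component on a root
    vector, since some weight of that vector is nonzero and would put the component into the
    bracket. *)
Lemma g2_cartan : cartan_subalgebra br (lspan b) (lspan [:: b`_6; b`_7]).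
Proof.
set H := lspan [:: _; _].
have Hsz : size [:: b`_6; b`_7] = 2%N by [].
have HL : H `<=` lspan b.
  apply: (lspan_sub Hsz) => // i ilt.
  by rewrite cartan_nth //; apply/Lb/pair_lt.
have br0 i j : (i < 2)%N -> (j < 2)%N -> br b`_(i + 6) b`_(j + 6) = 0.
  move=> ilt jlt; rewrite tab ?pair_lt // big1 // => k _.
  suff -> : g2_const (i + 6) (j + 6) k = 0 by rewrite raddf0 scale0r.
  by case: i ilt => [|[|//]] _; case: j jlt => [|[|//]] _; case: k;
    do 14?[case=> [//|]].
have brH x y : H x -> H y -> br x y = 0.
  move=> /(lspanP _ Hsz)[u ->] Hy; have Ly := HL _ Hy.
  have LH i : (i < 2)%N -> lspan b [:: b`_6; b`_7]`_i.
    by move=> ilt; rewrite cartan_nth //; apply/Lb/pair_lt.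
  rewrite (br_suml Lc bil) // big1 // => i _.
  have /(lspanP _ Hsz)[v ->] := Hy.
  rewrite (br_sumr Lc bil) //; last exact: LH.
  by rewrite big1 ?scaler0 // => j _; rewrite !cartan_nth // br0 // scaler0.
split=> //.
- split=> [|x y Hx Hy|a x y z /HL Lx /HL Ly /HL Lz|x Hx|x y z Hx Hy Hz].
  + exact: lspan_closed.
  + by rewrite brH //; have [] := lspan_closed [:: b`_6; b`_7].
  + exact: bil.
  + exact: brH.
  + have H0 : H 0 by have [] := lspan_closed [:: b`_6; b`_7].
    by rewrite [br y z]brH // [br z x]brH // [br x y]brH // !brH // !addr0.
(* An abelian algebra is killed by a single bracket. *)
- by exists 1%N => x [//|y [|//]] Hx Hs _ /=; apply: brH => //; apply: (Hs 0%N).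
move=> x /(lspanP _ bsz)[a xE] Nx.
have a0 i : (i < 14)%N -> i != 6%N -> i != 7%N -> a i = 0.
  move=> ilt i6 i7.
  have eig j : j = 6%N \/ j = 7%N -> a i * zr (g2_const i j i) = 0.
    move=> j67.
    have /Nx/(lspanP _ Hsz)[u] : H b`_j.
      by case: j67 => ->; [apply: (@lspan_nth _ _ _ 0%N)|
        apply: (@lspan_nth _ _ _ 1%N)].
    rewrite (g2_cartan_br j67 xE) => E.
    (* The coordinates of the bracket in the pair [H1], [H2], padded by 0 to fourteen, so that
       independence compares the two expansions. *)
    pose d k := if k == 6%N then u 0%N else if k == 7%N then u 1%N else 0.
    have := @lin_indepE _ _ b 14 (fun k => a k * zr (g2_const k j k) - d k)
      bsz ind _ i ilt.
    rewrite /d (negPf i6) (negPf i7) subr0; apply.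
    under eq_bigr do rewrite scalerBl.
    rewrite sumrB E; apply/eqP; rewrite subr_eq0; apply/eqP.
    rewrite big_ord_recl big_ord1 /= !big_ord_recl big_ord0 /d /=.
    by rewrite !scale0r !(add0r, addr0).
  have /allP/(_ i) := weight_check; rewrite mem_iota => /(_ ilt)/andP[_].
  rewrite (negPf i6) (negPf i7) !orbF => /orP[|] c0.
    have /eqP := eig _ (or_introl erefl).
    by rewrite mulf_eq0 zr_eq0 (negPf c0) orbF => /eqP.
  have /eqP := eig _ (or_intror erefl).
  by rewrite mulf_eq0 zr_eq0 (negPf c0) orbF => /eqP.
apply/(lspanP _ Hsz); exists (fun i => a (i + 6)%N).
rewrite xE [RHS]big_ord_recl big_ord1 /= !big_ord_recl big_ord0 /=.
rewrite !(a0 0%N, a0 1%N, a0 2%N, a0 3%N, a0 4%N, a0 5%N, a0 8%N, a0 9%N,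
  a0 10%N, a0 11%N, a0 12%N, a0 13%N) //.
by rewrite !scale0r ?(add0r, addr0).
Qed.

End G2Basis.

(** * Equal structure constants give isomorphic Lie algebras *)

Section Transport.
Context {R : realType} {V W : lmodType R}.
Variables (brV : V -> V -> V) (brW : W -> W -> W) (b : seq V) (d : seq W).
Hypotheses (bsz : size b = 14%N) (dsz : size d = 14%N).
Hypotheses (bbil : bilinear_on brV (lspan b)) (dbil : bilinear_on brW (lspan d)).
Hypotheses (btab : has_g2_brackets brV b) (dtab : has_g2_brackets brW d).
Hypotheses (bind : lin_indep b) (dind : lin_indep d).

Lemma g2_isomorphic : lie_isomorphic brV (lspan b) brW (lspan d).
Proof.
(* The isomorphism keeps coordinates, which are chosen on the span and set to 0 outside it;
   independence makes the choice unique below 14. *)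
have coord x : {a : nat -> R | lspan b x -> x = \sum_(i < 14) a i *: b`_i}.
  have [Lx|nLx] := pselect (lspan b x); last by exists (fun=> 0).
  by have /(lspanP _ bsz)/cid[a aE] := Lx; exists a.
pose f x : W := \sum_(i < 14) sval (coord x) i *: d`_i.
have fE (a : nat -> R) :
    f (\sum_(i < 14) a i *: b`_i) = \sum_(i < 14) a i *: d`_i.
  rewrite /f; case: (coord _) => c /= cE.
  apply: eq_bigr => i _; congr (_ *: _); apply/eqP; rewrite -subr_eq0; apply/eqP.
  apply: (lin_indepE (a := fun k => c k - a k) bsz bind) => //.
  under eq_bigr do rewrite scalerBl.
  by rewrite sumrB -cE ?subrr //; apply/(lspanP _ bsz); exists a.
have Lb i : (i < 14)%N -> lspan b b`_i by rewrite -bsz; exact: lspan_nth.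
have Ld i : (i < 14)%N -> lspan d d`_i by rewrite -dsz; exact: lspan_nth.
exists f; split.
- split.
  + move=> _ /(lspanP _ bsz)[a ->]; rewrite fE.
    by apply/(lspanP _ dsz); exists a.
  + move=> x y /set_mem/(lspanP _ bsz)[u ->] /set_mem/(lspanP _ bsz)[v ->].
    rewrite !fE => E; apply: eq_bigr => i _; congr (_ *: _).
    apply/eqP; rewrite -subr_eq0; apply/eqP.
    apply: (lin_indepE (a := fun k => u k - v k) dsz dind) => //.
    under eq_bigr do rewrite scalerBl.
    by rewrite sumrB E subrr.
  + move=> _ /(lspanP _ dsz)[a ->]; exists (\sum_(i < 14) a i *: b`_i) => //.
    by apply/(lspanP _ bsz); exists a.
- move=> a _ _ /(lspanP _ bsz)[u ->] /(lspanP _ bsz)[v ->].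
  rewrite scaler_sumr -big_split /=.
  under eq_bigr do rewrite scalerA -scalerDl.
  rewrite !fE (fE (fun i => a * u i + v i)) scaler_sumr -big_split /=.
  by apply: eq_bigr => i _; rewrite scalerA -scalerDl.
move=> x y /(lspanP _ bsz)[u ->] /(lspanP _ bsz)[v ->].
rewrite !fE.
rewrite (br_suml (lspan_closed b) bbil) //; last first.
  by apply/(lspanP _ bsz); exists v.
rewrite (br_suml (lspan_closed d) dbil) //; last first.
  by apply/(lspanP _ dsz); exists v.
(* Both brackets expand to this combination, one in the basis [b] and the other in [d], because the
   constants are the same. *)
transitivity (f (\sum_(k < 14) (\sum_(i < 14) \sum_(j < 14)
    u i * (v j * zr (g2_const i j k))) *: b`_k)).
  congr f; under [RHS]eq_bigr do rewrite scaler_suml.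
  rewrite exchange_big; apply: eq_bigr => i _ /=.
  rewrite (br_sumr (lspan_closed b) bbil) //; last exact: Lb.
  under [RHS]eq_bigr do rewrite scaler_suml.
  rewrite exchange_big scaler_sumr; apply: eq_bigr => j _ /=.
  by rewrite btab // !scaler_sumr; apply: eq_bigr => k _; rewrite !scalerA mulrA.
rewrite (fE (fun k => \sum_(i < 14) \sum_(j < 14)
    u i * (v j * zr (g2_const i j k)))).
under eq_bigr do rewrite scaler_suml.
rewrite exchange_big; apply: eq_bigr => i _ /=.
rewrite (br_sumr (lspan_closed d) dbil) //; last exact: Ld.
under eq_bigr do rewrite scaler_suml.
rewrite exchange_big scaler_sumr; apply: eq_bigr => j _ /=.
by rewrite dtab // !scaler_sumr; apply: eq_bigr => k _; rewrite !scalerA mulrA.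
Qed.

End Transport.

(** The alternating and Jacobi identities hold after applying [f], and [f] is injective on [L]. For
    vector fields this replaces an argument with second derivatives. *)
Lemma lie_algebra_transport (R : realType) (V W : lmodType R)
    (brV : V -> V -> V) (brW : W -> W -> W) (L : set V) (M : set W) :
  lin_closed L -> bilinear_on brV L -> (forall x y, L x -> L y -> L (brV x y)) ->
  is_lie_algebra brW M -> lie_isomorphic brV L brW M -> is_lie_algebra brV L.
Proof.
move=> Lc Lbil Lbr [[M0 _] Mbr _ Malt Mjac] [f [[fLM finj _] flin fbr]].
have f0 : f 0 = 0.
  have := flin 1 0 0 Lc.1 Lc.1; rewrite !scale1r addr0 => /esym/eqP.
  by rewrite -subr_eq0 addrK => /eqP.
have fD x y : L x -> L y -> f (x + y) = f x + f y.
  by move=> Lx Ly; have := flin 1 x y Lx Ly; rewrite !scale1r.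
have LD x y : L x -> L y -> L (x + y).
  by move=> Lx Ly; have := Lc.2 1 x y Lx Ly; rewrite !scale1r.
have f_eq0 x : L x -> f x = 0 -> x = 0.
  by move=> Lx fx; apply: finj; rewrite ?inE ?fx ?f0 //; exact: Lc.1.
split=> // [x Lx|x y z Lx Ly Lz].
  by apply: f_eq0; [exact: Lbr|rewrite fbr // Malt //; exact: fLM].
have Lxy := Lbr _ _ Lx Ly; have Lyz := Lbr _ _ Ly Lz; have Lzx := Lbr _ _ Lz Lx.
have [Lx' [Ly' Lz']] := (Lbr _ _ Lx Lyz, (Lbr _ _ Ly Lzx, Lbr _ _ Lz Lxy)).
apply: f_eq0; first exact/LD/Lz'/LD.
rewrite fD //; last exact: LD.
by rewrite fD // !fbr //; apply: Mjac; exact: fLM.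
Qed.

(** * Derivations of the split octonions *)

(* The pairs [(a, b)] with [e_a * e_b = e_k], resp. [- e_k]. *)
Definition oct_pos (k : nat) : seq (nat * nat) :=
  nth [::] [:: [:: (0, 0); (1, 2); (4, 7)]; [:: (0, 1); (1, 3); (5, 7)];
    [:: (2, 0); (3, 2); (6, 4)]; [:: (2, 1); (3, 3); (7, 4)];
    [:: (0, 4); (2, 5); (4, 3)]; [:: (1, 4); (3, 5); (5, 0)];
    [:: (0, 6); (2, 7); (6, 3)]; [:: (1, 6); (3, 7); (7, 0)]]%N k.
Definition oct_neg (k : nat) : seq (nat * nat) :=
  nth [::] [:: [:: (6, 5)]; [:: (7, 5)]; [:: (4, 6)]; [:: (5, 6)];
    [:: (5, 2)]; [:: (4, 1)]; [:: (7, 2)]; [:: (6, 1)]]%N k.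

Definition oct_table := Eval vm_compute in
  [seq [seq [seq (count_mem (a, b) (oct_pos k))%:R
                 - (count_mem (a, b) (oct_neg k))%:R : Z
    | k <- iota 0 8] | b <- iota 0 8] | a <- iota 0 8].

Definition oct_const (a b k : nat) : Z :=
  nth 0 (nth [::] (nth [::] oct_table a) b) k.

Lemma oct_constE a b k : (a < 8)%N -> (b < 8)%N -> (k < 8)%N ->
  oct_const a b k =
  (count_mem (a, b) (oct_pos k))%:R - (count_mem (a, b) (oct_neg k))%:R.
Proof.
move=> a8 b8 k8; rewrite /oct_const; have -> : oct_table =
  [seq [seq [seq (count_mem (a, b) (oct_pos k))%:R
                 - (count_mem (a, b) (oct_neg k))%:R : Z
    | k <- iota 0 8] | b <- iota 0 8] | a <- iota 0 8] by vm_compute.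
by rewrite !(nth_map 0%N) ?size_iota // !nth_iota.
Qed.

(* The coefficient of the entry [(i, j)] of a matrix [m] in the [k]-th
   coordinate of [m (e_a * e_b) - m e_a * e_b - e_a * m e_b]. *)
Definition leibniz_coef (a b k i j : nat) : Z :=
  (if i == k then oct_const a b j else 0)
  - (if j == a then oct_const i b k else 0)
  - (if j == b then oct_const a i k else 0).

Definition pairs (n : nat) : seq (nat * nat) :=
  [seq (i, j) | i <- iota 0 n, j <- iota 0 n].

Definition triples (n : nat) : seq (nat * nat * nat) :=
  [seq (ij, k) | ij <- pairs n, k <- iota 0 n].

Lemma mem_pairs n i j : ((i, j) \in pairs n) = (i < n)%N && (j < n)%N.
Proof.
apply/allpairsP/andP => [[[a b] /= [+ + [-> ->]]]|[ilt jlt]].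
  by rewrite !mem_iota.
by exists (i, j); rewrite !mem_iota.
Qed.

Lemma mem_triples n i j k :
  ((i, j, k) \in triples n) = [&& (i < n)%N, (j < n)%N & (k < n)%N].
Proof.
apply/allpairsP/and3P => [[[[a b] c] /= [+ + [-> -> ->]]]|[ilt jlt klt]].
  by rewrite mem_pairs mem_iota => /andP[? ?] ?; split.
by exists ((i, j), k); rewrite mem_pairs mem_iota ilt jlt.
Qed.

(* The [i]-th linear form on matrices takes a nonzero value on the [i]-th
   derivation of [der_basis] and vanishes on the others. *)
Definition der_form (i : nat) : seq (Z * (nat * nat)) :=
  nth [::] [:: [:: (1, (5, 1)%N)]; [:: (1, (7, 1)%N)]; [:: (1, (7, 6)%N)];
    [:: (1, (6, 7)%N)]; [:: (1, (7, 0)%N)]; [:: (1, (5, 3)%N)];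
    [:: (1, (6, 6)%N); (1, (7, 7)%N)]; [:: (1, (6, 6)%N); (-2, (7, 7)%N)];
    [:: (1, (2, 7)%N)]; [:: (1, (6, 1)%N)]; [:: (1, (7, 5)%N)];
    [:: (1, (7, 2)%N)]; [:: (1, (5, 2)%N)]; [:: (1, (5, 7)%N)]] i.

Definition der_scale : seq Z := [:: 1; 1; 1; 2; 2; 2; 6; 6; 6; -6; 6; 6; -6; 6].

Definition zform (f : seq (Z * (nat * nat))) (M : seq (seq Z)) : Z :=
  foldr (fun t z => t.1 * zent M t.2.1 t.2.2 + z) 0 f.

(* The entry [(i, j)], provided it is the only entry outside [known] on which the
   Leibniz identity [t] depends: it vanishes when those of [known] do. *)
Definition forced (known : seq (nat * nat)) (t : nat * nat * nat) :
    seq (nat * nat) :=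
  let: (a, b, k) := t in
  let s := [seq ij <- pairs 8 |
     (leibniz_coef a b k ij.1 ij.2 != 0) && (ij \notin known)] in
  if s is [:: _] then s else [::].

Definition propagate (known : seq (nat * nat)) : seq (nat * nat) :=
  flatten [seq forced known t | t <- triples 8] ++ known.

Definition pivots : seq (nat * nat) :=
  [:: (5, 1); (7, 1); (7, 6); (6, 7); (7, 0); (5, 3); (6, 6); (7, 7); (2, 7);
      (6, 1); (7, 5); (7, 2); (5, 2); (5, 7)]%N.

(** Two rounds starting from the fourteen pivots reach all 64 entries, so a derivation is determined
    by its pivots. *)
Lemma propagate_check :
  let s := propagate (propagate pivots) in
  all (fun i => all (fun j => (i, j) \in s) (iota 0 8)) (iota 0 8).
Proof. by vm_compute. Qed.

(** Up to the scales, the forms are dual to [der_basis]. *)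
Lemma der_form_check :
  all (fun i => all (fun j => zform (der_form i) (nth [::] der_basis j)
      == if i == j then nth 0 der_scale i else 0) (iota 0 14)) (iota 0 14).
Proof. by vm_compute. Qed.

(** The Leibniz identities are checked on the three generators; the other eleven elements are
    iterated commutators of these. *)
Lemma derivation_check :
  all (fun M => all (fun t => let: (a, b, k) := t in
      zsum 8 (fun l => zent M k l * oct_const a b l)
        == zsum 8 (fun l => zent M l a * oct_const l b k
                            + zent M l b * oct_const a l k)) (triples 8))
    [:: der1; der2; der3].
Proof. by vm_compute. Qed.

(** Certifies [g2_table]: each commutator is recomputed and compared, entry by entry, with the
    combination that the table prescribes. *)
Lemma der_table_check :
  all (fun i => all (fun j =>
      zcomm (nth [::] der_basis i) (nth [::] der_basis j) ==
      zmat 8 8 (fun r s =>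
        zsum 14 (fun k => g2_const i j k * zent (nth [::] der_basis k) r s)))
    (iota 0 14)) (iota 0 14).
Proof. by vm_compute. Qed.

(** Bridges the lists [oct_pos] and [oct_neg] with the full double sums weighted by [oct_const]. *)
Lemma sum_count (R : pzRingType) n (s : seq (nat * nat)) (F : nat -> nat -> R) :
  all (fun t => (t.1 < n)%N && (t.2 < n)%N) s ->
  \sum_(t <- s) F t.1 t.2 =
  \sum_(a < n) \sum_(b < n) (count_mem (a : nat, b : nat) s)%:R * F a b.
Proof.
elim: s => [|[a b] s IH] /=.
  by rewrite big_nil big1 // => a _; rewrite big1 // => b _; rewrite mul0r.
move=> /andP[/andP[an bn] sn]; rewrite big_cons IH //=.
under [RHS]eq_bigr do under eq_bigr do rewrite natrD mulrDl.
under [RHS]eq_bigr do rewrite big_split.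
rewrite [RHS]big_split /=; congr (_ + _).
rewrite (bigD1 (Ordinal an)) //= (bigD1 (Ordinal bn)) //= eqxx mul1r.
rewrite !big1 ?addr0 // => i.
  rewrite -val_eqE => /= /negPf ia; rewrite big1 // => j _.
  by rewrite xpair_eqE eq_sym ia mul0r.
by rewrite -val_eqE => /= /negPf ib; rewrite xpair_eqE [b == _]eq_sym ib andbF mul0r.
Qed.

(** * Coordinates on the split octonions and matrix entries of their endomorphisms *)

Section Octonions.
Context {R : realType}.
Local Notation O := (split_octonion R).
Implicit Types (x y : O) (D : 'End(O)).

Definition oct_coord x (k : nat) : R :=
  nth 0 [:: x.1 0 0; x.1 0 1; x.1 1 0; x.1 1 1;
            x.2 0 0; x.2 0 1; x.2 1 0; x.2 1 1] k.

Definition oct_of (a : nat -> R) : O :=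
  (\matrix_(i < 2, j < 2) a (2 * i + j)%N,
   \matrix_(i < 2, j < 2) a (4 + (2 * i + j))%N).

Lemma oct_coord_of (a : nat -> R) k : (k < 8)%N -> oct_coord (oct_of a) k = a k.
Proof. by do 8?[case: k => [_|k] //=; first by rewrite /oct_coord /= mxE]. Qed.

Lemma oct_coord_inj x y :
  (forall k, (k < 8)%N -> oct_coord x k = oct_coord y k) -> x = y.
Proof.
case: x y => [x1 x2] [y1 y2] E.
have two (i : 'I_2) : i = 0 \/ i = 1.
  by case: i => [[|[|//]] ?]; [left|right]; apply: val_inj.
congr (_, _); apply/matrixP => i j.
  by case: (two i) => ->; case: (two j) => ->;
    [exact: (E 0%N)|exact: (E 1%N)|exact: (E 2%N)|exact: (E 3%N)].
by case: (two i) => ->; case: (two j) => ->;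
  [exact: (E 4%N)|exact: (E 5%N)|exact: (E 6%N)|exact: (E 7%N)].
Qed.

Lemma oct_coord_lin (a : R) x y k :
  oct_coord (a *: x + y) k = a * oct_coord x k + oct_coord y k.
Proof.
case: x y => [x1 x2] [y1 y2].
by do 8?[case: k => [|k] /=; first by rewrite /oct_coord /= !mxE];
  rewrite /oct_coord /= !nth_nil mulr0 addr0.
Qed.

Lemma oct_coordD x y k : oct_coord (x + y) k = oct_coord x k + oct_coord y k.
Proof. by have := oct_coord_lin 1 x y k; rewrite scale1r mul1r. Qed.

Lemma oct_coord0 k : oct_coord (0 : O) k = 0.
Proof.
have := oct_coordD 0 0 k; rewrite addr0 => /esym/eqP.
by rewrite -subr_eq0 addrK => /eqP.
Qed.

Lemma oct_coordZ (a : R) x k : oct_coord (a *: x) k = a * oct_coord x k.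
Proof. by have := oct_coord_lin a x 0 k; rewrite addr0 oct_coord0 addr0. Qed.

Lemma oct_coordN x k : oct_coord (- x) k = - oct_coord x k.
Proof. by rewrite -scaleN1r oct_coordZ mulN1r. Qed.

Lemma oct_coordB x y k : oct_coord (x - y) k = oct_coord x k - oct_coord y k.
Proof. by rewrite oct_coordD oct_coordN. Qed.

Lemma oct_coord_sum n (F : 'I_n -> O) k :
  oct_coord (\sum_(i < n) F i) k = \sum_(i < n) oct_coord (F i) k.
Proof.
elim: n F => [|n IH] F; first by rewrite !big_ord0 oct_coord0.
by rewrite !big_ord_recr /= oct_coordD IH.
Qed.

Lemma oct_coord_mul x y k : (k < 8)%N ->
  oct_coord (omul x y) k =
  \sum_(a < 8) \sum_(b < 8) zr (oct_const a b k) * (oct_coord x a * oct_coord y b).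
Proof.
move=> k8.
(* Over the two lists the sums are explicit, and each coordinate can be compared with the
   Cayley-Dickson formula. *)
transitivity (\sum_(t <- oct_pos k) oct_coord x t.1 * oct_coord y t.2
              - \sum_(t <- oct_neg k) oct_coord x t.1 * oct_coord y t.2).
  case: x y => [x1 x2] [y1 y2].
  have sum2 (F : 'I_2 -> R) : \sum_(i < 2) F i = F 0 + F 1.
    by rewrite big_ord_recl big_ord1; congr (F _ + F _); apply: val_inj.
  have adj2 (M : 'M[R]_2) : [/\ \adj M 0 0 = M 1 1, \adj M 0 1 = - M 0 1,
      \adj M 1 0 = - M 1 0 & \adj M 1 1 = M 0 0].
    split; rewrite mxE /cofactor det_mx11 !mxE -signr_odd /= ?expr0 ?expr1
      ?mul1r ?mulN1r; try congr (- _); congr (M _ _); exact: val_inj.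
  have [a1 a2 a3 a4] := adj2 y1; have [b1 b2 b3 b4] := adj2 y2.
  do 8?[case: k k8 => [_|k k8] //=;
    first by rewrite !big_cons !big_nil /oct_coord /= !mxE !sum2
      ?(a1, a2, a3, a4, b1, b2, b3, b4); ring].
rewrite (sum_count (fun a b => oct_coord x a * oct_coord y b) (n := 8));
  last by move: k8; do 8?[case: k => [|k] //].
rewrite (sum_count (fun a b => oct_coord x a * oct_coord y b) (n := 8));
  last by move: k8; do 8?[case: k => [|k] //].
rewrite -sumrB; apply: eq_bigr => a _; rewrite -sumrB; apply: eq_bigr => b _.
by rewrite oct_constE // raddfB /= !rmorph_nat -mulrBl.
Qed.

Definition oct_basis (l : nat) : O := oct_of (fun k => (k == l)%:R).

Lemma oct_sum_basis x : x = \sum_(l < 8) oct_coord x l *: oct_basis l.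
Proof.
apply: oct_coord_inj => k k8; rewrite oct_coord_sum (bigD1 (Ordinal k8)) //=.
rewrite oct_coordZ oct_coord_of // eqxx mulr1 big1 ?addr0 // => i.
rewrite -val_eqE eq_sym => /= /negPf ik.
by rewrite oct_coordZ oct_coord_of // ik mulr0.
Qed.

Definition oct_entry D (k l : nat) : R := oct_coord (D (oct_basis l)) k.

Lemma oct_coord_lfun D x k :
  oct_coord (D x) k = \sum_(l < 8) oct_entry D k l * oct_coord x l.
Proof.
rewrite {1}(oct_sum_basis x) linear_sum oct_coord_sum; apply: eq_bigr => l _.
by rewrite linearZ oct_coordZ mulrC.
Qed.

Lemma oct_lfunP D D' :
  (forall k l, (k < 8)%N -> (l < 8)%N -> oct_entry D k l = oct_entry D' k l) ->
  D = D'.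
Proof.
move=> E; apply/lfunP => x; apply: oct_coord_inj => k k8.
by rewrite !oct_coord_lfun; apply: eq_bigr => l _; rewrite E.
Qed.

Lemma oct_entry_comm D D' k l : oct_entry (commutator D D') k l =
  \sum_(m < 8) (oct_entry D k m * oct_entry D' m l
               - oct_entry D' k m * oct_entry D m l).
Proof.
rewrite /oct_entry /commutator add_lfunE opp_lfunE !comp_lfunE oct_coordB.
by rewrite !oct_coord_lfun -sumrB.
Qed.

Lemma oct_entry_lin (a : R) D D' k l :
  oct_entry (a *: D + D') k l = a * oct_entry D k l + oct_entry D' k l.
Proof. by rewrite /oct_entry add_lfunE scale_lfunE oct_coord_lin. Qed.

Lemma oct_entry_sum n (F : 'I_n -> 'End(O)) k l :
  oct_entry (\sum_(i < n) F i) k l = \sum_(i < n) oct_entry (F i) k l.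
Proof. by rewrite /oct_entry sum_lfunE oct_coord_sum. Qed.

Lemma oct_coord_mul_basis (a b k : nat) : (a < 8)%N -> (b < 8)%N -> (k < 8)%N ->
  oct_coord (omul (oct_basis a) (oct_basis b)) k = zr (oct_const a b k).
Proof.
move=> a8 b8 k8; rewrite oct_coord_mul // (bigD1 (Ordinal a8)) //=.
rewrite (bigD1 (Ordinal b8)) //= !oct_coord_of // !eqxx !mulr1.
rewrite !big1 ?addr0 // => i; rewrite -val_eqE => /= /negPf ia; last first.
  by rewrite !oct_coord_of // ia !mulr0.
by rewrite big1 // => j _; rewrite !oct_coord_of // ia mul0r mulr0.
Qed.

(** Both sides of the Leibniz rule are bilinear in [x] and [y], so it suffices to compare
    coordinates on products of basis elements. *)
Lemma split_g2P D : split_g2 D <->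
  forall a b k, (a < 8)%N -> (b < 8)%N -> (k < 8)%N ->
    \sum_(l < 8) oct_entry D k l * zr (oct_const a b l) =
    \sum_(l < 8) (oct_entry D l a * zr (oct_const l b k)
                 + oct_entry D l b * zr (oct_const a l k)).
Proof.
have left_mul (x y : O) k : (k < 8)%N -> oct_coord (omul (D x) y) k =
    \sum_(a < 8) \sum_(b < 8) (\sum_(l < 8) oct_entry D l a * zr (oct_const l b k))
      * (oct_coord x a * oct_coord y b).
  move=> k8; rewrite oct_coord_mul // [LHS]exchange_big [RHS]exchange_big /=.
  apply: eq_bigr => b _; under eq_bigr do rewrite oct_coord_lfun mulr_suml mulr_sumr.
  rewrite exchange_big; apply: eq_bigr => a _ /=; rewrite mulr_suml.
  by apply: eq_bigr => l _; ring.
have right_mul (x y : O) k : (k < 8)%N -> oct_coord (omul x (D y)) k =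
    \sum_(a < 8) \sum_(b < 8) (\sum_(l < 8) oct_entry D l b * zr (oct_const a l k))
      * (oct_coord x a * oct_coord y b).
  move=> k8; rewrite oct_coord_mul //; apply: eq_bigr => a _.
  under eq_bigr do rewrite oct_coord_lfun !mulr_sumr.
  rewrite exchange_big; apply: eq_bigr => b _ /=; rewrite mulr_suml.
  by apply: eq_bigr => l _; ring.
split=> [der a b k a8 b8 k8|E x y].
  transitivity (oct_coord (D (omul (oct_basis a) (oct_basis b))) k).
    by rewrite oct_coord_lfun; apply: eq_bigr => l _; rewrite oct_coord_mul_basis.
  rewrite der oct_coordD left_mul // right_mul //.
  have delta (F : nat -> nat -> R) : \sum_(i < 8) \sum_(j < 8)
      F i j * (oct_coord (oct_basis a) i * oct_coord (oct_basis b) j) = F a b.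
    rewrite (bigD1 (Ordinal a8)) //= (bigD1 (Ordinal b8)) //=.
    rewrite !oct_coord_of // !eqxx !mulr1.
    rewrite !big1 ?addr0 // => i; rewrite -val_eqE => /= /negPf ia; last first.
      by rewrite !oct_coord_of // ia !mulr0.
    by rewrite big1 // => j _; rewrite !oct_coord_of // ia mul0r mulr0.
  rewrite (delta (fun a b => \sum_(l < 8) oct_entry D l a * zr (oct_const l b k))).
  rewrite (delta (fun a b => \sum_(l < 8) oct_entry D l b * zr (oct_const a l k))).
  by rewrite -big_split.
apply: oct_coord_inj => k k8; rewrite oct_coordD left_mul // right_mul //.
rewrite oct_coord_lfun -big_split /=.
under eq_bigr => l _ do rewrite oct_coord_mul // mulr_sumr.
rewrite exchange_big; apply: eq_bigr => a _ /=; rewrite -big_split /=.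
under eq_bigr => l _ do rewrite mulr_sumr.
rewrite exchange_big; apply: eq_bigr => b _ /=.
rewrite -mulrDl -big_split /= -E // mulr_suml.
by apply: eq_bigr => l _; ring.
Qed.

Lemma split_g2_closed : lin_closed (@split_g2 R).
Proof.
have omul_lin : lin_closed [set D : 'End(O) | split_g2 D].
  split=> [|a D D'] /=; first apply/split_g2P => a b k a8 b8 k8.
    have e0 i j : oct_entry 0 i j = 0 by rewrite /oct_entry zero_lfunE oct_coord0.
    by rewrite big1 ?big1 // => l _; rewrite !e0 !mul0r ?addr0.
  move=> /split_g2P E /split_g2P E'; apply/split_g2P => i j k i8 j8 k8.
  under eq_bigr do rewrite oct_entry_lin mulrDl -mulrA.
  rewrite big_split -mulr_sumr /= E // E' // mulr_sumr -big_split /=.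
  by apply: eq_bigr => l _; rewrite !oct_entry_lin; ring.
exact: omul_lin.
Qed.

End Octonions.

(** * The commutator bracket on endomorphisms *)

Section Commutator.
Context {R : realType} {U : vectType R}.
Implicit Types f g h : 'End(U).

Lemma commutatorE f g x : commutator f g x = f (g x) - g (f x).
Proof. by rewrite /commutator add_lfunE opp_lfunE !comp_lfunE. Qed.

Lemma commutator_bilinear : bilinear_on (@commutator R U) setT.
Proof.
move=> a f g h _ _ _; rewrite /commutator; split.
  rewrite comp_lfunDl comp_lfunDr -comp_lfunZl -comp_lfunZr scalerBr.
  by rewrite opprD addrACA.
rewrite comp_lfunDl comp_lfunDr -comp_lfunZl -comp_lfunZr scalerBr.
by rewrite opprD addrACA.
Qed.

Lemma commutator_jacobi f g h :
  commutator f (commutator g h) + commutator g (commutator h f)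
    + commutator h (commutator f g) = 0.
Proof.
(* The variables stand for the six triple composites of [f], [g], [h] at a point; each occurs twice
   with opposite signs, and the permutation pairs them. *)
have cancel (V : zmodType) (x1 x2 x3 x4 x5 x6 : V) :
    x1 - x2 - (x3 - x4) + (x3 - x5 - (x6 - x2)) + (x6 - x4 - (x1 - x5)) = 0.
  rewrite !opprB !addrA.
  rewrite [LHS](ACl ((1*12)*(2*7)*(3*10)*(4*5)*(6*11)*(8*9))).
  by rewrite /= !(subrr, addNr) !addr0.
have lfB (k : 'End(U)) u v : k (u - v) = k u - k v by exact: linearB.
apply/lfunP => x; rewrite !(add_lfunE, commutatorE) zero_lfunE !lfB.
exact: cancel.
Qed.

End Commutator.

Section Octonions.
Context {R : realType}.
Local Notation O := (split_octonion R).
Implicit Types (x y : O) (D : 'End(O)).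

Lemma split_g2_lie : is_lie_algebra (@commutator R _) (@split_g2 R).
Proof.
have omulD (x y z : O) : omul (x + y) z = omul x z + omul y z /\
    omul z (x + y) = omul z x + omul z y.
  split; apply: oct_coord_inj => k k8; rewrite oct_coordD !oct_coord_mul //;
    rewrite -big_split; apply: eq_bigr => a _ /=; rewrite -big_split;
    by apply: eq_bigr => b _ /=; rewrite oct_coordD; ring.
have endD (D : 'End(O)) u v : D (u + v) = D u + D v by exact: linearD.
split.
- exact: split_g2_closed.
(* The mixed products of [D x] with [D' y] and of [D' x] with [D y] occur in both composites and
   cancel. *)
- move=> D D' der der' x y; rewrite !commutatorE der' der !endD !der !der'.
  have [E1 _] := omulD (D (D' x)) (- D' (D x)) y.
  have [_ E2] := omulD (D (D' y)) (- D' (D y)) x.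
  apply: oct_coord_inj => k k8.
  have N1 (u v : O) : oct_coord (omul (- u) v) k = - oct_coord (omul u v) k.
    rewrite !oct_coord_mul // -sumrN; apply: eq_bigr => a _.
    rewrite -sumrN; apply: eq_bigr => b _.
    by rewrite oct_coordN; ring.
  have N2 (u v : O) : oct_coord (omul u (- v)) k = - oct_coord (omul u v) k.
    rewrite !oct_coord_mul // -sumrN; apply: eq_bigr => a _.
    rewrite -sumrN; apply: eq_bigr => b _.
    by rewrite oct_coordN; ring.
  by rewrite E1 E2 !(oct_coordN, oct_coordD) N1 N2; ring.
- by move=> a D D' E _ _ _; exact: commutator_bilinear.
- by move=> D _; rewrite /commutator subrr.
- by move=> D D' E _ _ _; exact: commutator_jacobi.
Qed.

End Octonions.

Lemma g2_gens_ind (T : Type) (P : T -> Prop) (br : T -> T -> T) (s1 s2 s3 t0 : T) :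
  (forall x y, P x -> P y -> P (br x y)) -> P s1 -> P s2 -> P s3 ->
  forall i, (i < 14)%N -> P (nth t0 (g2_gens br s1 s2 s3) i).
Proof.
move=> Pbr P1 P2 P3; have P4 := Pbr _ _ P1 P2; have P5 := Pbr _ _ P2 P3.
have P6 := Pbr _ _ P3 P1.
by do 14?[case=> [_|] /=; first by [|apply: Pbr]].
Qed.

Lemma der_form_bound i : (i < 14)%N ->
  all (fun t => (t.2.1 < 8)%N && (t.2.2 < 8)%N) (der_form i).
Proof. by do 14?[case: i => [|i] //]. Qed.

Lemma der_scale_neq0 i : (i < 14)%N -> nth 0 der_scale i != 0.
Proof. by do 14?[case: i => [|i] //]. Qed.

Lemma g2_gens_map (T T' : Type) (f : T -> T') (br : T -> T -> T)
    (br' : T' -> T' -> T') (s1 s2 s3 : T) :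
  (forall x y, f (br x y) = br' (f x) (f y)) ->
  map f (g2_gens br s1 s2 s3) = g2_gens br' (f s1) (f s2) (f s3).
Proof. by move=> fbr; rewrite /g2_gens /= !fbr. Qed.

(** * Fourteen integer matrices form a basis of the derivation algebra *)

Section DerivationBasis.
Context {R : realType}.
Local Notation O := (split_octonion R).
Implicit Types (x y : O) (D : 'End(O)) (M : seq (seq Z)).

Definition der_fun M x : O :=
  oct_of (fun k => \sum_(l < 8) zr (zent M k l) * oct_coord x l).

Lemma der_fun_is_linear M : linear (der_fun M).
Proof.
move=> a x y; apply: oct_coord_inj => k k8.
rewrite oct_coord_lin !oct_coord_of // mulr_sumr -big_split /=.
by apply: eq_bigr => l _; rewrite oct_coord_lin; ring.
Qed.

HB.instance Definition _ M :=
  GRing.isLinear.Build R O O _ (der_fun M) (@der_fun_is_linear M).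

Definition der_endo M : 'End(O) := linfun (der_fun M).

Lemma oct_entryZ (a : R) D k l : oct_entry (a *: D) k l = a * oct_entry D k l.
Proof. by rewrite /oct_entry scale_lfunE oct_coordZ. Qed.

Lemma oct_entry_der M k l : (k < 8)%N -> (l < 8)%N ->
  oct_entry (der_endo M) k l = zr (zent M k l) :> R.
Proof.
move=> k8 l8; rewrite /oct_entry lfunE /= oct_coord_of // (bigD1 (Ordinal l8)) //=.
rewrite oct_coord_of // eqxx mulr1 big1 ?addr0 // => i.
by rewrite -val_eqE => /= /negPf il; rewrite oct_coord_of // il mulr0.
Qed.

Lemma der_endo_comm M N :
  der_endo (zcomm M N) = commutator (der_endo M) (der_endo N).
Proof.
apply: oct_lfunP => k l k8 l8; rewrite oct_entry_comm oct_entry_der // zentE //.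
rewrite zr_sum; apply: eq_bigr => m _.
by rewrite !oct_entry_der // raddfB /= !rmorphM.
Qed.

Definition g2_derivations : seq 'End(O) := map der_endo der_basis.

Lemma g2_derivationsE : g2_derivations =
  g2_gens (@commutator R _) (der_endo der1) (der_endo der2) (der_endo der3).
Proof.
rewrite -(g2_gens_map der1 der2 der3 der_endo_comm) /g2_derivations.
by congr map; vm_compute.
Qed.

Lemma g2_derivations_nth i : (i < 14)%N ->
  g2_derivations`_i = der_endo (nth [::] der_basis i).
Proof. by move=> i14; rewrite (nth_map [::]). Qed.

Lemma g2_derivations_brackets : has_g2_brackets (@commutator R _) g2_derivations.
Proof.
move=> i j i14 j14; rewrite !g2_derivations_nth // -der_endo_comm.
have /allP/(_ i) := der_table_check; rewrite mem_iota => /(_ i14)/allP/(_ j).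
rewrite mem_iota => /(_ j14)/eqP ->; apply: oct_lfunP => r s r8 s8.
rewrite oct_entry_der // zentE // zr_sum oct_entry_sum; apply: eq_bigr => k _.
by rewrite oct_entryZ g2_derivations_nth // oct_entry_der // rmorphM.
Qed.

Lemma der_gen_derivation M : M \in [:: der1; der2; der3] ->
  split_g2 (der_endo M : 'End(O)).
Proof.
move=> M3; apply/split_g2P => a b k a8 b8 k8.
have /allP/(_ M M3)/allP/(_ (a, b, k)) := derivation_check.
rewrite mem_triples a8 b8 k8 => /(_ isT)/eqP/(congr1 (@zr R)).
rewrite !zr_sum => E.
transitivity (\sum_(l < 8) zr (zent M k l * oct_const a b l) : R).
  by apply: eq_bigr => l _; rewrite oct_entry_der // rmorphM.
rewrite E; apply: eq_bigr => l _.
by rewrite !oct_entry_der // raddfD /= !rmorphM.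
Qed.

Lemma g2_derivations_sub i : (i < 14)%N -> split_g2 g2_derivations`_i.
Proof.
have [_ brg _ _ _] := @split_g2_lie R.
rewrite g2_derivationsE; move: i; apply: g2_gens_ind; first exact: brg.
- exact: der_gen_derivation.
- exact: der_gen_derivation.
- exact: der_gen_derivation.
Qed.

Definition form_entry D (f : seq (Z * (nat * nat))) : R :=
  \sum_(t <- f) zr t.1 * oct_entry D t.2.1 t.2.2.

(** Collects a Leibniz identity by matrix entries, the form in which [forced] tests which entries it
    involves. *)
Lemma leibniz_entries D a b k : (a < 8)%N -> (b < 8)%N -> (k < 8)%N ->
  split_g2 D ->
  \sum_(i < 8) \sum_(j < 8) zr (leibniz_coef a b k i j) * oct_entry D i j = 0.
Proof.
move=> a8 b8 k8 /split_g2P/(_ a b k a8 b8 k8)/eqP; rewrite -subr_eq0 => /eqP E.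
rewrite -[RHS]E big_split /= opprD addrA.
have zr_if c z : zr (if c then z else 0) = c%:R * zr z :> R.
  by case: c; rewrite ?mul1r // mul0r raddf0.
have row F : \sum_(i < 8) \sum_(j < 8) (i == k :> nat)%:R * F i j
    = \sum_(j < 8) F (Ordinal k8) j :> R.
  rewrite (bigD1 (Ordinal k8)) //= eqxx [X in _ + X]big1 ?addr0 => [|i].
    by apply: eq_bigr => j _; rewrite mul1r.
  by rewrite -val_eqE => /= /negPf ik; rewrite big1 // => j _; rewrite ik mul0r.
have col c (c8 : (c < 8)%N) F : \sum_(i < 8) \sum_(j < 8) (j == c :> nat)%:R * F i j
    = \sum_(i < 8) F i (Ordinal c8) :> R.
  apply: eq_bigr => i _; rewrite (bigD1 (Ordinal c8)) //= eqxx mul1r.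
  rewrite big1 ?addr0 // => j.
  by rewrite -val_eqE => /= /negPf jc; rewrite jc mul0r.
transitivity (\sum_(i < 8) \sum_(j < 8)
  ((i == k :> nat)%:R * (oct_entry D i j * zr (oct_const a b j))
   - (j == a :> nat)%:R * (oct_entry D i j * zr (oct_const i b k))
   - (j == b :> nat)%:R * (oct_entry D i j * zr (oct_const a i k)))).
  apply: eq_bigr => i _; apply: eq_bigr => j _.
  by rewrite /leibniz_coef !raddfB /= !zr_if; ring.
under [LHS]eq_bigr do rewrite !sumrB.
rewrite !sumrB (row (fun i j => oct_entry D i j * zr (oct_const a b j))).
rewrite (col a a8 (fun i j => oct_entry D i j * zr (oct_const i b k))).
by rewrite (col b b8 (fun i j => oct_entry D i j * zr (oct_const a i k))).
Qed.

Definition vanishes D (s : seq (nat * nat)) :=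
  forall ij, ij \in s -> (ij.1 < 8)%N -> (ij.2 < 8)%N -> oct_entry D ij.1 ij.2 = 0.

(** A Leibniz identity whose only entry outside [s] is [(i, j)] reduces to a nonzero integer times
    that entry. *)
Lemma propagate_vanishes D s : split_g2 D -> vanishes D s ->
  vanishes D (propagate s).
Proof.
move=> der s0 [i j]; rewrite mem_cat => /orP[|]; last exact: s0.
case/flattenP => l /mapP[[[a b] k]]; rewrite mem_triples => /and3P[a8 b8 k8] ->.
rewrite /forced; set T := seq.filter _ _.
case TE : T => [|t [|]] //; rewrite inE => /eqP tE /= i8 j8.
have := leibniz_entries a8 b8 k8 der.
have other p q : (p < 8)%N -> (q < 8)%N -> (p, q) != (i, j) ->
    zr (leibniz_coef a b k p q) * oct_entry D p q = 0.
  move=> p8 q8 pq; have : (p, q) \notin T by rewrite TE inE -tE.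
  rewrite mem_filter negb_and negb_and negbK negbK.
  rewrite mem_pairs p8 q8 orbF.
  move=> /orP[/eqP /= ->|/s0/(_ p8 q8) /= ->]; last by rewrite mulr0.
  by rewrite raddf0 mul0r.
rewrite (bigD1 (Ordinal i8)) //= (bigD1 (Ordinal j8)) //= !big1 ?addr0; last 2 first.
- move=> p; rewrite -val_eqE => /= pi; rewrite big1 // => q _; apply: other => //.
  by rewrite xpair_eqE negb_and pi.
- move=> q; rewrite -val_eqE => /= qj; apply: other => //.
  by rewrite xpair_eqE negb_and qj orbT.
have : (i, j) \in T by rewrite TE inE tE.
rewrite mem_filter => /andP[/andP[/= c0 _] _] /eqP.
by rewrite mulf_eq0 zr_eq0 (negPf c0) => /eqP.
Qed.

Lemma form_entry_lin D (a : nat -> R) n (F : nat -> 'End(O)) f :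
  form_entry (D - \sum_(i < n) a i *: F i) f =
  form_entry D f - \sum_(i < n) a i * form_entry (F i) f.
Proof.
have entryE k l : oct_entry (D - \sum_(i < n) a i *: F i) k l =
    oct_entry D k l - \sum_(i < n) a i * oct_entry (F i) k l.
  rewrite /oct_entry add_lfunE opp_lfunE oct_coordB sum_lfunE oct_coord_sum.
  by congr (_ - _); apply: eq_bigr => i _; rewrite scale_lfunE oct_coordZ.
rewrite /form_entry; under eq_bigr do rewrite entryE mulrBr.
rewrite sumrB; congr (_ - _); under [RHS]eq_bigr do rewrite mulr_sumr.
rewrite exchange_big; apply: eq_bigr => t _ /=.
by rewrite mulr_sumr; apply: eq_bigr => i _; ring.
Qed.

(** The forms read off candidate coordinates of [D]. Subtracting the corresponding combination
    leaves a derivation on which all forms vanish, hence all pivots, hence every entry by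
    propagation. *)
Lemma split_g2_span : lspan g2_derivations = @split_g2 R.
Proof.
apply/seteqP; split=> [|D der].
  apply: (lspan_sub (n := 14%N)) => //; first exact: split_g2_closed.
  exact: g2_derivations_sub.
pose a i := form_entry D (der_form i) / zr (nth 0 der_scale i).
have sz : size g2_derivations = 14%N by rewrite size_map.
apply/(lspanP _ sz); exists a.
apply/eqP; rewrite -subr_eq0; apply/eqP.
set D' := D - _.
have der' : split_g2 D'.
  rewrite /D' -scaleN1r addrC; apply: (@split_g2_closed R).2 => //.
  apply: (closed_sum a (x := nth 0 g2_derivations) (@split_g2_closed R)).
  exact: g2_derivations_sub.
have form0 i : (i < 14)%N -> form_entry D' (der_form i) = 0.
  move=> i14; rewrite form_entry_lin; apply/eqP; rewrite subr_eq0; apply/eqP.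
  have formE j : (j < 14)%N -> form_entry g2_derivations`_j (der_form i) =
      if i == j then zr (nth 0 der_scale i) else 0.
    move=> j14; have /allP/(_ i) := der_form_check.
    rewrite mem_iota => /(_ i14)/allP/(_ j); rewrite mem_iota => /(_ j14)/eqP E.
    transitivity (zr (zform (der_form i) (nth [::] der_basis j)) : R); last first.
      by rewrite E; case: eqP => // _; rewrite raddf0.
    rewrite g2_derivations_nth // /form_entry /zform.
    elim: (der_form i) (der_form_bound i14) => [|t f IH] /=.
      by rewrite big_nil raddf0.
    by move=> /andP[/andP[t1 t2] f8]; rewrite big_cons IH // oct_entry_der //
      raddfD /= rmorphM.
  rewrite (bigD1 (Ordinal i14)) //= formE // eqxx big1 ?addr0 => [|j].
    by rewrite /a divfK // zr_eq0 der_scale_neq0.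
  by rewrite -val_eqE eq_sym => /= /negPf ij; rewrite formE // ij mulr0.
have entry0 i k l : (i < 14)%N -> der_form i = [:: (1, (k, l))] ->
    oct_entry D' k l = 0.
  move=> /form0 + fE; rewrite fE /form_entry big_seq1 /=.
  by rewrite rmorph1 mul1r.
(* Forms 6 and 7 mix two diagonal entries; as they are independent, both entries vanish. Each other
   form is a single pivot. *)
have [e66 e77] : oct_entry D' 6 6 = 0 /\ oct_entry D' 7 7 = 0.
  have := form0 6%N isT; have := form0 7%N isT.
  rewrite /form_entry /= !big_cons !big_nil /= !rmorph1 !mul1r !addr0.
  have -> : zr (-2) = -2 :> R.
    by rewrite (_ : (-2 : Z) = - (2%:R)) // raddfN rmorph_nat.
  by move=> f7 f6; split; lra.
have piv : vanishes D' pivots.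
{ move=> ij; rewrite !inE.
  do 13?[case/orP => [/eqP -> _ _ /=|]]; last move=> /eqP -> _ _ /=.
  all: by [exact: e66|exact: e77|apply: (entry0 0%N)|apply: (entry0 1%N)
    |apply: (entry0 2%N)|apply: (entry0 3%N)|apply: (entry0 4%N)
    |apply: (entry0 5%N)|apply: (entry0 8%N)|apply: (entry0 9%N)
    |apply: (entry0 10%N)|apply: (entry0 11%N)|apply: (entry0 12%N)
    |apply: (entry0 13%N)]. }
have all0 := propagate_vanishes der' (propagate_vanishes der' piv).
apply: oct_lfunP => k l k8 l8.
have /allP/(_ k) := propagate_check; rewrite mem_iota => /(_ k8)/allP/(_ l).
rewrite mem_iota => /(_ l8) /all0/(_ k8 l8) /= ->.
by rewrite /oct_entry zero_lfunE oct_coord0.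
Qed.

End DerivationBasis.

(** * Polynomial vector fields with integer coefficients *)

Inductive pexp := PC of Z | PV of nat | PA of pexp & pexp | PM of pexp & pexp.

Fixpoint pev (R : pzRingType) (xs : seq R) (e : pexp) : R :=
  match e with
  | PC z => zr z
  | PV i => nth 0 xs i
  | PA e1 e2 => pev xs e1 + pev xs e2
  | PM e1 e2 => pev xs e1 * pev xs e2
  end.

Fixpoint pder (i : nat) (e : pexp) : pexp :=
  match e with
  | PC _ => PC 0
  | PV j => PC (j == i)%:R
  | PA e1 e2 => PA (pder i e1) (pder i e2)
  | PM e1 e2 => PA (PM (pder i e1) e2) (PM e1 (pder i e2))
  end.

Fixpoint pexpr (e : pexp) : PExpr Z :=
  match e with
  | PC z => PEc z
  | PV i => PEX _ (Pos.of_succ_nat i)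
  | PA e1 e2 => PEadd (pexpr e1) (pexpr e2)
  | PM e1 e2 => PEmul (pexpr e1) (pexpr e2)
  end.

(** The sparse Horner normal form of the [ring] tactic over [Z], computed without rewriting
    hypotheses. *)
Definition pnf (e : pexp) : Pol Z :=
  norm_subst Z.zero Z.one Z.add Z.mul Z.sub Z.opp Z.eqb Z.quotrem 0%N [::]
    (pexpr e).

Definition peq (e1 e2 : pexp) : bool := Ring_polynom.Peq Z.eqb (pnf e1) (pnf e2).

(* Only used to keep the expressions in [flat_basis] small: nothing is proved
   about it, since [flat_table_check] covers the brackets defining [flat_basis]. *)
Fixpoint pexp_of_pol (i : nat) (p : Pol Z) : pexp :=
  match p with
  | Ring_polynom.Pc z => PC z
  | Ring_polynom.Pinj j q => pexp_of_pol (i + Pos.to_nat j)%N q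
  | Ring_polynom.PX p k q => PA (PM (pexp_of_pol i p)
                       (iter (Pos.to_nat k).-1 (fun e => PM e (PV i)) (PV i)))
                   (pexp_of_pol i.+1 q)
  end.

(** The normalizer numbers variables by positives from 1, while [PV] numbers them from 0. *)
Lemma BinList_nth (T : Type) (x0 : T) (s : seq T) i :
  BinList.nth x0 (Pos.of_succ_nat i) s = nth x0 s i.
Proof.
have hd_nth p (l : seq T) :
    BinList.nth x0 (Pos.succ p) l = BinList.nth x0 p (List.tl l).
  elim: p l => [p IH|p IH|] l //=.
  by rewrite IH -!jump_tl jump_succ.
elim: i s => [|i IH] [|x s] //=; rewrite hd_nth IH //=; exact: nth_nil.
Qed.

(** Since [zr] is a ring morphism, equality of normal forms over [Z] implies equality of values in
    every commutative ring. *)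
Lemma peq_correct (R : comPzRingType) (xs : seq R) (e1 e2 : pexp) :
  peq e1 e2 -> pev xs e1 = pev xs e2.
Proof.
have rt : ring_theory (0 : R) 1 +%R *%R (fun x y => x - y) -%R eq.
  split; [exact: add0r|exact: addrC|exact: addrA|exact: mul1r|exact: mulrC|
    exact: mulrA|exact: mulrDl|by []|exact: subrr].
have ext : ring_eq_ext +%R *%R -%R (@eq R) by split=> ? ? -> // ? ? ->.
have mor : ring_morph (0 : R) 1 +%R *%R (fun x y => x - y) -%R eq
    Z.zero Z.one Z.add Z.mul Z.sub Z.opp Z.eqb (@zr R).
  split; [exact: raddf0|exact: rmorph1|exact: raddfD|exact: raddfB|exact: rmorphM|
    exact: raddfN|by move=> x y /Z.eqb_eq ->].
have pow : power_theory (1 : R) *%R eq id (@pow_N R 1 *%R) by split.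
have dv : div_theory (@eq R) Z.add Z.mul (@zr R) Z.quotrem.
  exact: (Ztriv_div_th (Eqsth R) (@zr R)).
have E e : pev xs e = PEeval 0 1 +%R *%R (fun x y => x - y) -%R (@zr R) id
    (@pow_N R 1 *%R) xs (pexpr e).
  by elim: e => [z|i|a IHa b IHb|a IHa b IHb] //=;
    rewrite ?BinList_nth // IHa IHb.
move=> eq12; rewrite !E.
exact: (ring_correct (Eqsth R) ext (Rth_ARth (Eqsth R) ext rt) mor pow dv 0%N xs
  [::] _ _ I eq12).
Qed.

Definition psum (n : nat) (f : nat -> pexp) : pexp :=
  foldr (fun k e => PA (f k) e) (PC 0) (iota 0 n).

Lemma pev_sum (R : pzRingType) (xs : seq R) n (f : nat -> pexp) :
  pev xs (psum n f) = \sum_(k < n) pev xs (f k).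
Proof.
rewrite -(big_mkord xpredT (fun k => pev xs (f k))) /index_iota subn0 /psum.
elim: (iota 0 n) => [|k s IH]; first by rewrite big_nil /= raddf0.
by rewrite big_cons /= IH.
Qed.

Definition pnth (P : seq pexp) (k : nat) : pexp := nth (PC 0) P k.

Definition pbr (P Q : seq pexp) : seq pexp :=
  [seq psum 5 (fun i => PA (PM (pnth P i) (pder i (pnth Q k)))
                           (PM (PC (-1)) (PM (pnth Q i) (pder i (pnth P k)))))
  | k <- iota 0 5].

Section FlatFields.
Local Notation u := (PV 0).
Local Notation v := (PV 1).
Local Notation x := (PV 2).
Local Notation y := (PV 3).
Local Notation w := (PV 4).
Local Infix "+" := PA.
Local Infix "*" := PM.
Local Notation r2 := (x * x + y * y).

(* The components of the [S^i] in the order [d_u, d_v, d_x, d_y, d_w]. *)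
Definition flat1 : seq pexp := [:: PC 0; r2; PC 0; PC (-1); x].
Definition flat2 : seq pexp := [:: r2; PC 0; PC 1; PC 0; y].
Definition flat3 : seq pexp :=
  [:: PC 2 * w * w * y + PC 4 * r2 * w * x + PC (-1) * r2 * r2 * y
        + PC (-3) * v * r2;
      PC 2 * w * w * x + PC (-4) * r2 * w * y + PC (-1) * r2 * r2 * x
        + PC 3 * u * r2;
      PC 4 * w * x + PC (-1) * r2 * y + PC (-3) * v;
      PC 4 * w * y + r2 * x + PC (-3) * u;
      w * w + PC (-1) * r2 * r2 + PC (-3) * v * y + PC 3 * u * x].
End FlatFields.

Definition flat_basis : seq (seq pexp) := Eval vm_compute in
  g2_gens (fun P Q => [seq pexp_of_pol 0 (pnf e) | e <- pbr P Q]) flat1 flat2 flat3.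

(** The polynomial fields have the structure constants of the octonion derivations, verified
    component by component. *)
Lemma flat_table_check :
  all (fun i => all (fun j =>
      let br := pbr (nth [::] flat_basis i) (nth [::] flat_basis j) in
      all (fun m => peq (pnth br m)
        (psum 14 (fun k => PM (PC (g2_const i j k)) (pnth (nth [::] flat_basis k) m))))
    (iota 0 5)) (iota 0 14)) (iota 0 14).
Proof. by vm_compute. Qed.

(** * Elementary functions on the configuration space *)

Section Elementary.
Context {R : realType}.
Implicit Types (p v : 'rV[R]_5).

(** A class of functions containing all components in play and stable under directional derivatives,
    which makes both differentiation and smoothness symbolic where [h] is nonzero. *)
Inductive efun :=
  | ECst of R | ECrd of 'I_5 | ESin | ECos | EInv
  | EAdd of efun & efun | EMul of efun & efun.

Fixpoint eev (e : efun) p : R :=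
  match e with
  | ECst r => r
  | ECrd i => p 0 i
  | ESin => sin (psi_ p)
  | ECos => cos (psi_ p)
  | EInv => (h_ p)^-1
  | EAdd e1 e2 => eev e1 p + eev e2 p
  | EMul e1 e2 => eev e1 p * eev e2 p
  end.

Fixpoint eder v (e : efun) : efun :=
  match e with
  | ECst _ => ECst 0
  | ECrd i => ECst (v 0 i)
  | ESin => EMul ECos (ECst (psi_ v))
  | ECos => EMul (ECst (- psi_ v)) ESin
  | EInv => EMul (ECst (- h_ v)) (EMul EInv EInv)
  | EAdd e1 e2 => EAdd (eder v e1) (eder v e2)
  | EMul e1 e2 => EAdd (EMul (eder v e1) e2) (EMul e1 (eder v e2))
  end.

Lemma differentiable_coord5 (i : 'I_5) p v :
  differentiable (fun q : 'rV[R]_5 => q 0 i) p /\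
  'D_v (fun q : 'rV[R]_5 => q 0 i) p = v 0 i.
Proof.
have dif : differentiable (fun q : 'rV[R]_5 => q 0 i) p.
  exact: differentiable_coord.
split=> //; rewrite deriveE //.
have lin : linear (fun q : 'rV[R]_5 => q 0 i) by move=> a x y; rewrite !mxE.
(* A coordinate is continuous and linear, hence its own differential. *)
pose f := HB.pack (fun q : 'rV[R]_5 => q 0 i)
  (GRing.isLinear.Build R 'rV[R]_5 R _ _ lin) : {linear 'rV[R]_5 -> R}.
have fc : continuous f by move=> q; exact: coord_continuous.
by rewrite -[(fun q : 'rV[R]_5 => q 0 i)]/(f : _ -> _) diff_lin.
Qed.

Lemma derive_comp1 (f : 'rV[R]_5 -> R) (g : R -> R) (dg : R) p v :
  differentiable f p -> is_derive (f p) 1 g dg ->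
  differentiable (g \o f) p /\ 'D_v (g \o f) p = dg * 'D_v f p.
Proof.
move=> df [dg1 dgE]; have dg' : differentiable g (f p) by apply/derivable1_diffP.
have dgf : differentiable (g \o f) p by apply: differentiable_comp.
split=> //; rewrite !deriveE // diff_comp //=.
by rewrite deriv1E //= derive1E dgE mulrC.
Qed.

Lemma eevP (e : efun) p v : h_ p != 0 ->
  differentiable (eev e) p /\ 'D_v (eev e) p = eev (eder v e) p.
Proof.
move=> h0; elim: e => [r|i||||e1 [d1 E1] e2 [d2 E2]|e1 [d1 E1] e2 [d2 E2]] /=.
- by split; [exact: differentiable_cst|exact: derive_cst].
- exact: differentiable_coord5.
- have [dpsi Epsi] := differentiable_coord5 4 p v.
  by have [? ->] := derive_comp1 v dpsi (is_derive_sin (psi_ p)); rewrite Epsi.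
- have [dpsi Epsi] := differentiable_coord5 4 p v.
  have [? ->] := derive_comp1 v dpsi (is_derive_cos (psi_ p)); split=> //.
  by rewrite Epsi mulNr mulrC mulNr.
- have [dh Eh] := differentiable_coord5 2 p v.
  split; first exact: differentiableV.
  rewrite deriveV //; last exact: diff_derivable.
  by rewrite Eh -exprVn expr2 [LHS]/GRing.scale /= -[v 0 2]/(h_ v) !mulNr mulrC.
- split; first exact: differentiableD.
  by rewrite deriveD ?E1 ?E2 //; exact: diff_derivable.
split; first exact: differentiableM.
rewrite deriveM ?E1 ?E2 //; try exact: diff_derivable.
by rewrite /GRing.scale /= addrC mulrC.
Qed.

Lemma eder_sum (e : efun) p n (a : nat -> R) (v : nat -> 'rV[R]_5) :
  eev (eder (\sum_(i < n) a i *: v i) e) p =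
  \sum_(i < n) a i * eev (eder (v i) e) p.
Proof.
have coordE j : (\sum_(i < n) a i *: v i) 0 j = \sum_(i < n) a i * v i 0 j.
  by rewrite summxE; apply: eq_bigr => i _; rewrite mxE.
elim: e => [r|i||||e1 IH1 e2 IH2|e1 IH1 e2 IH2] /=.
- by rewrite big1 // => i _; rewrite mulr0.
- exact: coordE.
- by rewrite /psi_ coordE mulr_sumr; apply: eq_bigr => i _; ring.
- by rewrite /psi_ coordE -sumrN mulr_suml; apply: eq_bigr => i _; ring.
- by rewrite /h_ coordE -sumrN mulr_suml; apply: eq_bigr => i _; ring.
- by rewrite IH1 IH2 -big_split; apply: eq_bigr => i _ /=; ring.
rewrite IH1 IH2 mulr_suml mulr_sumr -big_split.
by apply: eq_bigr => i _ /=; ring.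
Qed.

Definition efield (F : 'I_5 -> efun) p : 'rV[R]_5 := \row_m eev (F m) p.

Lemma efieldP (F : 'I_5 -> efun) p v : h_ p != 0 ->
  differentiable (efield F) p /\
  'D_v (efield F) p = efield (fun m => eder v (F m)) p.
Proof.
move=> h0.
have dif : differentiable (efield F) p.
  have -> : efield F = \sum_(m < 5) (fun q => eev (F m) q *: (delta_mx 0 m : 'rV[R]_5)).
    apply/funext => q; rewrite fct_sumE [LHS]row_sum_delta.
    by apply: eq_bigr => m _; rewrite mxE.
  apply: differentiable_sum => m; apply: differentiableZl.
  by have [] := eevP (F m) v h0.
split=> //; rewrite derive_mx; last exact: diff_derivable.
apply/rowP => m; rewrite !mxE.
have [_ <-] := eevP (F m) v h0.
by congr ('D_v _ p); apply/funext => q; rewrite mxE.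
Qed.

End Elementary.

(** * The flat coordinates *)

Section FlatCoordinates.
Context {R : realType}.
Variables (kappa c : R).
Hypothesis hc : c != 0.
Implicit Types (p v : 'rV[R]_5).

Let U := conf_space kappa c.
Let ex : @efun R := EMul (ECrd 2) ECos.
Let ey : @efun R := EMul (ECrd 2) ESin.

Definition flat_coord : seq (@efun R) :=
  let a := ECst (- (2 * c ^+ 3)) in
  let k := kappa * c ^+ 2 in
  [:: EAdd (EMul a (ECrd 0)) (EMul (ECst k) ex);
      EAdd (EMul a (ECrd 1)) (EMul (ECst (- k)) ey);
      ex; ey;
      EAdd (EMul a (ECrd 3)) (EMul (ECst (- k)) (ECrd 4))].

(* The components on [d_theta, d_phi, d_h, d_q, d_psi] of the partial derivative
   along the [k]-th flat coordinate; missing components are [0]. *)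
Definition flat_frame (k : nat) (m : 'I_5) : @efun R :=
  let i := ECst (- (2 * c ^+ 3)^-1) in
  let a := kappa / (2 * c) in
  nth (ECst 0) (nth [::]
    [:: [:: i];
        [:: ECst 0; i];
        [:: ECst a; ECst 0; ECos; EMul (ECst a) (EMul ESin EInv);
            EMul (ECst (-1)) (EMul ESin EInv)];
        [:: ECst 0; ECst (- a); ESin; EMul (ECst (- a)) (EMul ECos EInv);
            EMul ECos EInv];
        [:: ECst 0; ECst 0; ECst 0; i]] k) m.

Definition flat_point p : seq R := [seq eev e p | e <- flat_coord].

Definition frame_vec (k : nat) p : 'rV[R]_5 := efield (flat_frame k) p.

Fixpoint esub (e : pexp) : @efun R :=
  match e with
  | PC z => ECst (zr z)
  | PV i => nth (ECst 0) flat_coord i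
  | PA e1 e2 => EAdd (esub e1) (esub e2)
  | PM e1 e2 => EMul (esub e1) (esub e2)
  end.

Lemma eev_esub e p : eev (esub e) p = pev (flat_point p) e.
Proof.
elim: e => [z|i|e1 IH1 e2 IH2|e1 IH1 e2 IH2] //=; rewrite ?IH1 ?IH2 //.
have [i5|i5] := ltnP i 5; first by rewrite (nth_map (ECst 0)).
by rewrite !nth_default ?size_map.
Qed.

Lemma eder_esub e p v : eev (eder v (esub e)) p =
  \sum_(j < 5) pev (flat_point p) (pder j e)
    * eev (eder v (nth (ECst 0) flat_coord j)) p.
Proof.
elim: e => [z|i|e1 IH1 e2 IH2|e1 IH1 e2 IH2].
- by rewrite /= big1 // => j _; rewrite raddf0 mul0r.
- have pE j : pev (flat_point p) (pder j (PV i)) = (i == j)%:R.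
    by rewrite /= rmorph_nat.
  rewrite -[esub _]/(nth (ECst 0) flat_coord i); under eq_bigr do rewrite pE.
  have [i5|i5] := ltnP i 5; last first.
    rewrite nth_default // big1 // => j _.
    by rewrite gtn_eqF ?mul0r // (leq_trans (ltn_ord j)).
  rewrite (bigD1 (Ordinal i5)) //= eqxx mul1r big1 ?addr0 // => j.
  by rewrite -val_eqE eq_sym => /= /negPf ->; rewrite mul0r.
- by rewrite /= IH1 IH2 -big_split; apply: eq_bigr => j _ /=; ring.
rewrite /= IH1 IH2 !eev_esub mulr_suml mulr_sumr -big_split.
by apply: eq_bigr => j _ /=; ring.
Qed.

Lemma cos2sin2_psi p : cos (psi_ p) * cos (psi_ p) = 1 - sin (psi_ p) * sin (psi_ p).
Proof. by rewrite -!expr2 cos2sin2. Qed.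

(** Identifies the frame as dual to the differentials of the flat coordinates; besides field
    arithmetic only [cos^2 + sin^2 = 1] enters. *)
Lemma frame_dual p k j : h_ p != 0 -> (k < 5)%N -> (j < 5)%N ->
  eev (eder (frame_vec k p) (nth (ECst 0) flat_coord j)) p = (j == k)%:R.
Proof.
move=> h0; have cs := cos2sin2_psi p.
(* This product occurs when the differential of [h sin psi] is paired with its own frame vector. *)
have hC : h_ p * (cos (psi_ p) * (cos (psi_ p) / h_ p)) =
    1 - sin (psi_ p) * sin (psi_ p) by rewrite -cs; field.
do 5?[case: k => [_|k]] => //; do 5?[case: j => [_|j]] => //=;
  rewrite /frame_vec /psi_ /h_ !mxE /= -/(psi_ p) -/(h_ p).
all: by rewrite ?hC ?cs; field; rewrite ?hc ?h0.
Qed.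

(** Coordinate vector fields commute; here this is checked on the explicit components, half of the
    cases following by symmetry. *)
Lemma frame_comm p i k m : h_ p != 0 -> (i < 5)%N -> (k < 5)%N ->
  eev (eder (frame_vec i p) (flat_frame k m)) p =
  eev (eder (frame_vec k p) (flat_frame i m)) p.
Proof.
move=> h0; wlog ik : i k / (i <= k)%N => [sym i5 k5|].
  by case: (leqP i k) => [|/ltnW] ik; [|symmetry]; apply: sym.
rewrite /frame_vec; case: m => m m5.
do 5?[case: i ik => [|i] ik] => // _; do 5?[case: k ik => [|k] ik] => // _ //;
  do 5?[case: m m5 => [|m] m5] => //=; rewrite /psi_ /h_ !mxE /=.
all: by rewrite -?/(psi_ p) -?/(h_ p); field; rewrite ?hc ?h0.
Qed.

Definition flat_comp (P : seq pexp) (m : 'I_5) : @efun R :=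
  foldr (fun k e => EAdd (EMul (esub (pnth P k)) (flat_frame k m)) e) (ECst 0)
    (iota 0 5).

Lemma eev_flat_comp P m p : eev (flat_comp P m) p =
  \sum_(k < 5) pev (flat_point p) (pnth P k) * eev (flat_frame k m) p.
Proof.
by rewrite /flat_comp /= !eev_esub !big_ord_recl big_ord0.
Qed.

Lemma eder_flat_comp P m p v : eev (eder v (flat_comp P m)) p =
  \sum_(k < 5) (eev (eder v (esub (pnth P k))) p * eev (flat_frame k m) p
    + pev (flat_point p) (pnth P k) * eev (eder v (flat_frame k m)) p).
Proof.
by rewrite /flat_comp /= !eev_esub !big_ord_recl big_ord0.
Qed.

Definition flat_field (P : seq pexp) : 'rV[R]_5 -> 'rV[R]_5 :=
  extend0 U (efield (flat_comp P)).

Lemma flat_vecE P p : efield (flat_comp P) p =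
  \sum_(k < 5) pev (flat_point p) (pnth P k) *: frame_vec k p.
Proof.
apply/rowP => m; rewrite summxE mxE eev_flat_comp.
by apply: eq_bigr => k _; rewrite !mxE.
Qed.

(* The frame commutes, so only the derivatives of the components contribute. *)
Lemma flat_bracket P Q p m : h_ p != 0 ->
  eev (eder (efield (flat_comp P) p) (flat_comp Q m)) p
    - eev (eder (efield (flat_comp Q) p) (flat_comp P m)) p =
  eev (flat_comp (pbr P Q) m) p.
Proof.
move=> h0; pose a S k := pev (flat_point p) (pnth S k).
pose d i S k := pev (flat_point p) (pder i (pnth S k)).
(* By duality of the frame, a flat field differentiates polynomials in the flat coordinates by the
   usual formula. *)
have dir S T k : (k < 5)%N -> eev (eder (efield (flat_comp S) p) (esub (pnth T k))) p =
    \sum_(i < 5) a S i * d i T k.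
  move=> k5; rewrite flat_vecE (eder_sum _ _ _ (a S) (frame_vec^~ p)).
  apply: eq_bigr => i _; congr (_ * _).
  rewrite eder_esub (bigD1 i) //= frame_dual // eqxx mulr1 big1 ?addr0 // => j.
  by rewrite -val_eqE => /= /negPf ji; rewrite frame_dual // ji mulr0.
have frd S k : (k < 5)%N -> eev (eder (efield (flat_comp S) p) (flat_frame k m)) p =
    \sum_(i < 5) a S i * eev (eder (frame_vec i p) (flat_frame k m)) p.
  by move=> k5; rewrite flat_vecE (eder_sum _ _ _ (a S) (frame_vec^~ p)).
rewrite !eder_flat_comp eev_flat_comp !big_split /= opprD addrACA.
rewrite [X in _ + X](_ : _ = 0) ?addr0.
  rewrite -sumrB; apply: eq_bigr => k _; rewrite !dir // -mulrBl; congr (_ * _).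
  rewrite /pbr /pnth (nth_map 0%N) ?size_iota // nth_iota // pev_sum -sumrB.
  apply: eq_bigr => i _ /=; rewrite /a /d /pnth add0n.
  by rewrite (_ : (-1 : Z) = - 1%:R) // raddfN rmorph1 mulN1r.
apply/eqP; rewrite subr_eq0; apply/eqP.
under eq_bigr => k _ do rewrite frd // mulr_sumr.
under [RHS]eq_bigr => k _ do rewrite frd // mulr_sumr.
rewrite exchange_big; apply: eq_bigr => i _; apply: eq_bigr => k _ /=.
by rewrite (frame_comm m h0 (ltn_ord k) (ltn_ord i)) -/(a P i) -/(a Q k); ring.
Qed.

End FlatCoordinates.

(** * Smooth vector fields *)

(** Applied to a difference, this carries differentiability between fields that agree on an open
    set, in particular to extensions by zero. *)
Lemma near0_differentiable (R : realType) (V W : normedModType R) (f : V -> W) (p : V) :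
  (\forall q \near p, f q = 0) -> differentiable f p.
Proof.
move=> f0; have fp : f p = 0 by exact: nbhs_singleton f0.
apply/diffP => /=.
(* The differential is defined by choice, so it suffices to exhibit one linear map with the required
   expansion, namely the zero map. *)
apply: (@getPex _ (fun (df : {linear V -> W}) => continuous df /\
  forall y, f y = f (lim (nbhs p)) + df (y - lim (nbhs p))
                  +o_(y \near p) (y - lim (nbhs p)))).
exists (\0 : {linear V -> W}); split; first by move=> q; exact: cvg_cst.
have H : f = (fun y => f (lim (nbhs p)) + (\0 : {linear V -> W}) (y - lim (nbhs p)))
    +o_ (nbhs p) (fun y => y - lim (nbhs p)).
  apply/eqaddoP => eps eps0; rewrite lim_id // fp.
  near=> y; have fy : f y = 0 by near: y.
  by rewrite /= !fctE fy /= addr0 subrr normr0 mulr_ge0 // ltW.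
by move=> y; rewrite [LHS](congr1 (@^~ y) H).
Unshelve. all: by end_near. Qed.

Section VectorFields.
Context {R : realType} (U : set 'rV[R]_5).
Hypothesis Uo : open U.
Implicit Types (p v : 'rV[R]_5) (X Y : 'rV[R]_5 -> 'rV[R]_5).

Let near_eq X Y p : U p -> {in U, X =1 Y} -> \forall q \near p, X q = Y q.
Proof.
move=> Up XY; have := open_nbhs_nbhs (conj Uo Up).
by apply: filterS => q Uq; apply: XY; rewrite inE.
Qed.

Lemma derive_eq_on X Y p v : U p -> {in U, X =1 Y} -> 'D_v X p = 'D_v Y p.
Proof. by move=> Up XY; apply: near_eq_derive; exact: near_eq. Qed.

Lemma differentiable_eq_on X Y p : U p -> {in U, X =1 Y} ->
  differentiable X p -> differentiable Y p.
Proof.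
move=> Up XY dX; have -> : Y = X + (Y - X) by rewrite addrC subrK.
apply: (differentiableD dX); apply: near0_differentiable.
apply: filterS (near_eq Up XY) => q XYq.
by rewrite !fctE XYq subrr.
Qed.

Lemma Cn_on_eq n X Y : {in U, X =1 Y} -> Cn_on n U X -> Cn_on n U Y.
Proof.
elim: n X Y => [|n IH] X Y XY /=.
  move=> cX p Up; have XYp : X p = Y p by apply: XY; rewrite inE.
  change (Y x @[x --> p] --> Y p); rewrite -XYp.
  apply: (cvg_trans _ (cX p Up)); apply: (@near_eq_cvg _ _ (nbhs p)).
  exact: (near_eq Up XY).
move=> [dX cX]; split=> [p Up|v]; first exact: differentiable_eq_on (dX p Up).
apply: (IH _ _ _ (cX v)) => p; rewrite inE => Up.
exact: derive_eq_on.
Qed.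

Lemma Cn_on_comb n (a : R) X Y : Cn_on n U X -> Cn_on n U Y -> Cn_on n U (a *: X + Y).
Proof.
elim: n X Y => [|n IH] X Y /=.
  move=> cX cY p Up.
  have ca : {for p, continuous (fun=> a : R^o)} by exact: cst_continuous.
  exact: (continuousD (continuousZ ca (cX p Up)) (cY p Up)).
move=> [dX cX] [dY cY]; split=> [p Up|v].
  by apply: differentiableD; [apply: differentiableZ; exact: dX|exact: dY].
apply: Cn_on_eq (IH _ _ (cX v) (cY v)) => p; rewrite inE => Up.
have dX' : derivable X p v by apply: diff_derivable; exact: dX.
have dY' : derivable Y p v by apply: diff_derivable; exact: dY.
have DE : 'D_v (a *: X + Y) p = 'D_v (a *: X) p + 'D_v Y p.
  exact: (deriveD (derivableZ (k := a) dX') dY').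
have ZE : 'D_v (a *: X) p = a *: 'D_v X p by exact: (deriveZ a dX').
exact: (esym (etrans DE (congr1 (+%R^~ ('D_v Y p)) ZE))).
Qed.

Lemma vector_fields_closed : lin_closed (vector_fields U).
Proof.
split=> [|a X Y [X0 cX] [Y0 cY]]; last first.
  split=> [p nUp|n]; last exact: Cn_on_comb.
  by rewrite [LHS](_ : _ = a *: X p + Y p) // X0 // Y0 // scaler0 addr0.
split=> // n; elim: n => [|n IH] /=.
  move=> p _; have c0 : continuous (cst 0 : 'rV[R]_5 -> 'rV[R]_5).
    exact: cst_continuous.
  exact: c0.
split=> [p _|v]; first exact: differentiable_cst.
apply: Cn_on_eq IH => p _; rewrite [RHS](_ : _ = 'D_v (cst 0) p) //.
by rewrite derive_cst.
Qed.

Lemma vector_fields_differentiable X p : vector_fields U X -> U p ->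
  differentiable X p.
Proof. by move=> [_ /(_ 1%N) [dX _]]; exact: dX. Qed.

(** Linearity in the direction is that of the differential, and linearity in the differentiated
    field is the sum rule. Outside [U] the fields vanish and every derivative is taken along 0. *)
Lemma vbracket_bilinear : bilinear_on (@vbracket R) (vector_fields U).
Proof.
have key (a : R) X Y Z p : vector_fields U X -> vector_fields U Y ->
    vector_fields U Z ->
    'D_((a *: X + Y) p) Z p = a *: 'D_(X p) Z p + 'D_(Y p) Z p /\
    'D_(Z p) (a *: X + Y) p = a *: 'D_(Z p) X p + 'D_(Z p) Y p.
  move=> vX vY vZ; have [Up|nUp] := pselect (U p); last first.
    have [/(_ _ nUp) E _] := vector_fields_closed.2 a _ _ vX vY.
    have [X0 _] := vX; have [Y0 _] := vY; have [Z0 _] := vZ.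
    by rewrite E X0 // Y0 // Z0 // !derive0 scaler0 addr0.
  have dX := vector_fields_differentiable vX Up.
  have dY := vector_fields_differentiable vY Up.
  have dZ := vector_fields_differentiable vZ Up; split.
    rewrite !deriveE // [(a *: X + Y) p](_ : _ = a *: X p + Y p) //.
    by rewrite linearD linearZ.
  have [dX' dY'] := (diff_derivable (v := Z p) dX, diff_derivable (v := Z p) dY).
  have DE : 'D_(Z p) (a *: X + Y) p = 'D_(Z p) (a *: X) p + 'D_(Z p) Y p.
    exact: (deriveD (derivableZ (k := a) dX') dY').
  by rewrite DE; congr (_ + _); exact: (deriveZ a dX').
move=> a X Y Z vX vY vZ; split; apply/funext => p; rewrite /vbracket;
  have [E1 E2] := key a X Y Z p vX vY vZ; rewrite E1 E2.
  rewrite [RHS](_ : _ = a *: ('D_(X p) Z p - 'D_(Z p) X p) +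
    ('D_(Y p) Z p - 'D_(Z p) Y p)) //.
  by rewrite scalerBr opprD addrACA.
rewrite [RHS](_ : _ = a *: ('D_(Z p) X p - 'D_(X p) Z p) +
  ('D_(Z p) Y p - 'D_(Y p) Z p)) //.
by rewrite scalerBr opprD addrACA.
Qed.

Lemma extend0_in X : {in U, X =1 extend0 U X}.
Proof. by move=> p pU; rewrite /extend0 patchT. Qed.

Lemma extend0_out X p : ~ U p -> extend0 U X p = 0.
Proof. by move=> nUp; rewrite /extend0 patchC // inE. Qed.

(** Derivatives of elementary fields are elementary, so the induction on the order runs over all [F]
    at once. *)
Lemma efield_smooth (F : 'I_5 -> efun) : (forall p, U p -> h_ p != 0) ->
  vector_fields U (extend0 U (efield F)).
Proof.
move=> h0; split=> [p nUp|n]; first exact: extend0_out.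
apply: Cn_on_eq (@extend0_in _) _; elim: n F => [|n IH] F /=.
  move=> p Up; apply: differentiable_continuous.
  by have [] := efieldP F 0 (h0 p Up).
split=> [p Up|v]; first by have [] := efieldP F 0 (h0 p Up).
apply: Cn_on_eq (IH (fun m => eder v (F m))) => p; rewrite inE => Up.
by have [_ ->] := efieldP F v (h0 p Up).
Qed.

Lemma vbracket_efield (F G : 'I_5 -> efun) : (forall p, U p -> h_ p != 0) ->
  vbracket (extend0 U (efield F)) (extend0 U (efield G)) =
  extend0 U (fun p => \row_m (eev (eder (efield F p) (G m)) p
                              - eev (eder (efield G p) (F m)) p)).
Proof.
move=> h0; apply/funext => p; rewrite /vbracket.
have [Up|nUp] := pselect (U p); last first.
  by rewrite !extend0_out // !derive0 subr0.
rewrite -!(extend0_in _ (mem_set Up)).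
rewrite -(derive_eq_on _ Up (@extend0_in (efield F))).
rewrite -(derive_eq_on _ Up (@extend0_in (efield G))).
have [_ ->] := efieldP G (efield F p) (h0 p Up).
have [_ ->] := efieldP F (efield G p) (h0 p Up).
by apply/rowP => m; rewrite !mxE.
Qed.

End VectorFields.

(** * The rolling fields *)

Section FlatFields.
Context {R : realType}.
Variables (kappa c : R).
Hypothesis hc : c != 0.
Let U := conf_space kappa c.

Lemma conf_space_open : open U.
Proof.
have hcont : continuous (@h_ R) by move=> p; exact: coord_continuous.
have -> : U = h_ @^-1` ([set x | 0 < x] `&`
    (fun x => x ^+ 2) @^-1` [set x | x != kappa * c ^+ 2]) by [].
apply: open_comp; first by move=> p _; exact: hcont.
apply: openI; first exact: open_gt.
apply: open_comp; last exact: open_neq.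
by move=> x _; exact: exprn_continuous.
Qed.

Lemma conf_space_h p : U p -> h_ p != 0.
Proof. by move=> [/lt0r_neq0]. Qed.

Lemma conf_space_inhabited : exists p, U p.
Proof.
pose pt (x : R) : 'rV[R]_5 := x *: d_h.
have hpt x : h_ (pt x) = x by rewrite /h_ !mxE /= mulr1.
(* The point with [h = 1] is admissible unless [kappa c^2 = 1], in which case [h = 2] is. *)
have [E|E] := eqVneq (kappa * c ^+ 2) 1.
  by exists (pt 2); split; rewrite hpt // E; lra.
by exists (pt 1); split; rewrite hpt // expr1n eq_sym.
Qed.

Definition flat_fields := [seq flat_field kappa c P | P <- flat_basis].

Lemma flat_fields_nth i : (i < 14)%N ->
  flat_fields`_i = flat_field kappa c (nth [::] flat_basis i).
Proof. by move=> i14; rewrite (nth_map [::]). Qed.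

Lemma flat_fields_smooth i : (i < 14)%N -> vector_fields U flat_fields`_i.
Proof.
move=> i14; rewrite flat_fields_nth //.
apply: efield_smooth; [exact: conf_space_open|exact: conf_space_h].
Qed.

Lemma flat_fields_brackets : has_g2_brackets (@vbracket R) flat_fields.
Proof.
move=> i j i14 j14; rewrite !flat_fields_nth //.
rewrite vbracket_efield; [|exact: conf_space_open|exact: conf_space_h].
apply/funext => p; rewrite fct_sumE.
have termE (k : 'I_14) : (zr (g2_const i j k) *: flat_fields`_k) p =
    zr (g2_const i j k) *: flat_field kappa c (nth [::] flat_basis k) p.
  by rewrite flat_fields_nth.
under eq_bigr do rewrite termE.
have [Up|nUp] := pselect (U p); last first.
  rewrite extend0_out // big1 // => k _.
  by rewrite [X in _ *: X]extend0_out // scaler0.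
rewrite -extend0_in ?inE //; apply/rowP => m; rewrite mxE summxE.
rewrite flat_bracket //; last exact: conf_space_h.
rewrite eev_flat_comp.
transitivity (\sum_(k < 14) zr (g2_const i j k) *
    eev (flat_comp kappa c (nth [::] flat_basis k) m) p); last first.
  apply: eq_bigr => k _; rewrite [RHS]mxE; congr (_ * _).
  by rewrite /flat_field -extend0_in ?inE // mxE.
under [RHS]eq_bigr do rewrite eev_flat_comp mulr_sumr.
rewrite exchange_big; apply: eq_bigr => n _ /=.
have /allP/(_ i) := flat_table_check; rewrite mem_iota => /(_ i14)/allP/(_ j).
rewrite mem_iota => /(_ j14)/allP/(_ n); rewrite mem_iota => /(_ (ltn_ord n)).
move=> /(peq_correct (flat_point kappa c p)) ->; rewrite pev_sum mulr_suml.
by apply: eq_bigr => k _ /=; rewrite mulrA.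
Qed.

(** In flat coordinates [L1] is the constant field [2 d_u], whose theta component is [- 1 / c^3]. *)
Lemma flat_fields_neq0 : flat_fields`_8 != 0.
Proof.
have [p Up] := conf_space_inhabited; apply/eqP => E.
have : (flat_fields`_8 : 'rV[R]_5 -> 'rV[R]_5) p 0 0 = 0 by rewrite E mxE.
rewrite flat_fields_nth // /flat_field -(extend0_in _ (mem_set Up)) mxE.
rewrite eev_flat_comp !big_ord_recl big_ord0 /=.
rewrite !raddf0 !mul0r !addr0 => /eqP; rewrite mulf_eq0 zr_eq0 oppr_eq0.
by move=> /orP[//|]; rewrite invr_eq0 mulf_eq0 pnatr_eq0 expf_eq0 (negPf hc).
Qed.

End FlatFields.

Section RollingFields.
Context {R : realType}.
Variables (kappa c : R).
Hypothesis hc : c != 0.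
Implicit Types p : 'rV[R]_5.
Let U := conf_space kappa c.

Let zrE : ((zr 0 = 0 :> R) * (zr 1 = 1 :> R) * (zr 2 = 2 :> R) * (zr 3 = 3 :> R)
  * (zr 4 = 4 :> R) * (zr (-1) = -1 :> R) * (zr (-3) = -3 :> R)
  * (zr (-4) = -4 :> R))%type.
Proof.
by do !split.
Qed.

Lemma gfac_neq0 p : U p -> kappa * c ^+ 2 - h_ p ^+ 2 != 0.
Proof. by move=> [_ hk]; rewrite subr_eq0 eq_sym. Qed.

Lemma rolling_S1_S2 p : U p ->
  rolling_distribution kappa c p (S1_field kappa c p) /\
  rolling_distribution kappa c p (S2_field kappa c p).
Proof.
move=> Up; have h0 := conf_space_h Up; have k0 := gfac_neq0 Up.
have cs : cos (psi_ p) ^+ 2 = 1 - sin (psi_ p) ^+ 2 by rewrite cos2sin2.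
rewrite /h_ in h0 k0; rewrite /psi_ in cs.
split; split; rewrite /omega1 /omega2 /omega3 /gfac /S1_field /S2_field
  /theta_ /phi_ /h_ /q_ /psi_ !mxE /=; field: cs; rewrite ?hc ?h0 ?k0 //.
Qed.

Let cos2_psi p : cos (p 0 4) ^+ 2 = 1 - sin (p 0 4) ^+ 2.
Proof. by rewrite cos2sin2. Qed.

(** Here and for the next two fields, expanding the frame gives rational identities modulo
    [cos^2 + sin^2 = 1]. *)
Lemma S1_fieldE p : U p -> S1_field kappa c p = efield (flat_comp kappa c flat1) p.
Proof.
move=> /conf_space_h; rewrite /h_ => h0; have cs := cos2_psi p.
apply/rowP => m; rewrite [RHS]mxE eev_flat_comp !big_ord_recl big_ord0.
case: m => [[|[|[|[|[|//]]]]] m5];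
  by rewrite !mxE /= !zrE /theta_ /phi_ /h_ /q_ /psi_; field: cs; rewrite ?hc ?h0.
Qed.

Lemma S2_fieldE p : U p -> S2_field kappa c p = efield (flat_comp kappa c flat2) p.
Proof.
move=> /conf_space_h; rewrite /h_ => h0; have cs := cos2_psi p.
apply/rowP => m; rewrite [RHS]mxE eev_flat_comp !big_ord_recl big_ord0.
case: m => [[|[|[|[|[|//]]]]] m5];
  by rewrite !mxE /= !zrE /theta_ /phi_ /h_ /q_ /psi_; field: cs; rewrite ?hc ?h0.
Qed.

Lemma S3_fieldE p : U p -> S3_field kappa c p = efield (flat_comp kappa c flat3) p.
Proof.
move=> /conf_space_h; rewrite /h_ => h0; have cs := cos2_psi p.
apply/rowP => m; rewrite [RHS]mxE eev_flat_comp !big_ord_recl big_ord0.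
case: m => [[|[|[|[|[|//]]]]] m5];
  by rewrite !mxE /= !zrE /theta_ /phi_ /h_ /q_ /psi_; field: cs; rewrite ?hc ?h0.
Qed.

End RollingFields.

(** * Recovering the bracket recipe, and rescaling the Cartan elements *)

Section G2Generators.
Context {R : realType} {V : lmodType R}.
Variables (br : V -> V -> V) (b : seq V).
Hypotheses (bsz : size b = 14%N) (tab : has_g2_brackets br b).

(** For each bracket of the recipe the row of constants is a unit vector, so the recipe applied to
    the first three vectors returns the whole basis. *)
Lemma g2_gens_brackets : g2_gens br b`_0 b`_1 b`_2 = b.
Proof.
have unit i j k : (i < 14)%N -> (j < 14)%N -> (k < 14)%N ->
    all (fun m => g2_const i j m == (m == k)%:R) (iota 0 14) -> br b`_i b`_j = b`_k.
  move=> i14 j14 k14 /allP E.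
  have Em m : (m < 14)%N -> g2_const i j m = (m == k)%:R.
    by move=> m14; apply/eqP/E; rewrite mem_iota.
  rewrite tab // (bigD1 (Ordinal k14)) //= Em // eqxx rmorph1 scale1r big1 ?addr0 //.
  move=> m; rewrite -val_eqE /= => /negPf mk.
  by rewrite Em // mk raddf0 scale0r.
apply: (@eq_from_nth _ 0) => // i i14; rewrite /= in i14; move: i i14.
rewrite /g2_gens (unit 0 1 3)%N // (unit 1 2 4)%N // (unit 2 0 5)%N //.
rewrite (unit 1 5 6)%N // (unit 3 2 7)%N // (unit 0 3 8)%N // (unit 1 3 9)%N //.
rewrite (unit 1 4 10)%N // (unit 2 4 11)%N // (unit 2 5 12)%N //.
by rewrite (unit 0 5 13)%N //; do 14?[case=> //].
Qed.

Variables (x y : R).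
Hypotheses (x0 : x != 0) (y0 : y != 0).

Let t1 : V := x *: (b`_7 - b`_6).
Let t2 : V := y *: (b`_6 + b`_7).
Let B := [:: b`_0; b`_1; b`_2; b`_3; b`_4; b`_5; t1; t2;
             b`_8; b`_9; b`_10; b`_11; b`_12; b`_13].

Let half (z : V) : z = 2^-1 *: z + 2^-1 *: z.
Proof. by rewrite -scalerDl (_ : 2^-1 + 2^-1 = 1) ?scale1r //; field. Qed.

Let t1E : (2 * x)^-1 *: t1 = 2^-1 *: b`_7 - 2^-1 *: b`_6.
Proof. by rewrite scalerA scalerBr (_ : (2 * x)^-1 * x = 2^-1) //; field. Qed.

Let t2E : (2 * y)^-1 *: t2 = 2^-1 *: b`_6 + 2^-1 *: b`_7.
Proof. by rewrite scalerA scalerDr (_ : (2 * y)^-1 * y = 2^-1) //; field. Qed.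

Let b6E : b`_6 = - (2 * x)^-1 *: t1 + (2 * y)^-1 *: t2.
Proof. by rewrite scaleNr t1E t2E opprB addrACA addNr addr0 -half. Qed.

Let b7E : b`_7 = (2 * x)^-1 *: t1 + (2 * y)^-1 *: t2.
Proof. by rewrite t1E t2E [X in _ + X]addrC addrACA addNr addr0 -half. Qed.

Lemma lspan_cartan : lspan [:: t1; t2] = lspan [:: b`_6; b`_7].
Proof.
have comb (u v z : V) (c d : R) : z = c *: u + d *: v -> lspan [:: u; v] z.
  have sz : size [:: u; v] = 2%N by [].
  move=> ->; apply/(lspanP _ sz); exists (fun i => if i == 0%N then c else d).
  by rewrite big_ord_recl big_ord1.
apply/seteqP; split; apply: (lspan_sub (n := 2%N)) => //;
  try exact: lspan_closed; case=> [|[|//]] _ /=.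
- by apply: (comb _ _ _ (- x) x); rewrite /t1 scalerBr scaleNr addrC.
- by apply: (comb _ _ _ y y); rewrite /t2 scalerDr.
- exact: comb b6E.
exact: comb b7E.
Qed.

Lemma lspan_cartan_basis : lspan B = lspan b.
Proof.
have Lb i : (i < 14)%N -> lspan b b`_i by rewrite -bsz; exact: lspan_nth.
have LB i : (i < 14)%N -> lspan B B`_i by move=> ?; exact: lspan_nth.
have Bsz : size B = 14%N by [].
have [b0 bD] := lspan_closed b; have [B0 BD] := lspan_closed B.
have Z (s : seq V) (c : R) z : lspan s z -> lspan s (c *: z).
  move=> sz; have [s0 sD] := lspan_closed s.
  by have := sD c z 0 sz s0; rewrite addr0.
apply/seteqP; split.
  apply: (lspan_sub Bsz (lspan_closed b)).
  do 6?[case=> [_|]; first exact: Lb].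
  case=> [_|].
    by apply: Z; rewrite addrC -scaleN1r; apply: bD; exact: Lb.
  case=> [_|].
    by apply: Z; rewrite -[b`_6]scale1r; apply: bD; exact: Lb.
  by do 6?[case=> [_|//]; first exact: Lb].
apply: (lspan_sub bsz (lspan_closed B)).
case=> [_|]; first exact: (LB 0%N).
case=> [_|]; first exact: (LB 1%N).
case=> [_|]; first exact: (LB 2%N).
case=> [_|]; first exact: (LB 3%N).
case=> [_|]; first exact: (LB 4%N).
case=> [_|]; first exact: (LB 5%N).
case=> [_|]; first by rewrite b6E; apply: BD; [exact: (LB 6%N)|exact/Z/(LB 7%N)].
case=> [_|]; first by rewrite b7E; apply: BD; [exact: (LB 6%N)|exact/Z/(LB 7%N)].
case=> [_|]; first exact: (LB 8%N).
case=> [_|]; first exact: (LB 9%N).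
case=> [_|]; first exact: (LB 10%N).
case=> [_|]; first exact: (LB 11%N).
case=> [_|]; first exact: (LB 12%N).
by case=> [_|//]; exact: (LB 13%N).
Qed.

Lemma lin_indep_cartan_basis : lin_indep b -> lin_indep B.
Proof.
move=> ind; apply: (lin_indepP (n := 14%N)) => // a aB.
(* The coefficients of the relation rewritten in [b]; the change of basis in positions 6 and 7 is
   invertible as [x] and [y] are nonzero. *)
pose a' k := if k == 6%N then - (x * a 6%N) + y * a 7%N
  else if k == 7%N then x * a 6%N + y * a 7%N else a k.
have a'0 k : (k < 14)%N -> a' k = 0.
  apply: (lin_indepE bsz ind); rewrite -[RHS]aB !big_ord_recl !big_ord0 /a' /=.
  do 6 congr (_ + _); rewrite /t1 /t2 !addrA; congr (_ + _ + _ + _ + _ + _ + _ + _).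
  rewrite !scalerA !scalerDr !scalerN !scalerDl !scaleNr ![x * _]mulrC ![y * _]mulrC.
  by rewrite addrACA [X in X + _]addrC.
have s6 := a'0 6%N isT; have s7 := a'0 7%N isT; rewrite /a' /= in s6 s7.
have a7 : a 7%N = 0.
  have : 2 * y * a 7%N = 0 by lra.
  by move/eqP; rewrite !mulf_eq0 (negPf y0) pnatr_eq0 /= => /eqP.
have a6 : a 6%N = 0.
  move: s7; rewrite a7 mulr0 addr0 => /eqP.
  by rewrite mulf_eq0 (negPf x0) => /eqP.
move=> i i14; have := a'0 i i14; rewrite /a'.
by case: eqP => [->//|_]; case: eqP => [->//|_].
Qed.

End G2Generators.

Theorem theorem3p2 (R : realType) (kappa c : R) (hc : c != 0) :
  (forall p : 'rV[R]_5, conf_space kappa c p ->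
     rolling_distribution kappa c p (S1_field kappa c p) /\
     rolling_distribution kappa c p (S2_field kappa c p)) /\
  pairwise_bracket_generate_split_g2 (conf_space kappa c)
    (extend0 (conf_space kappa c) (S1_field kappa c))
    (extend0 (conf_space kappa c) (S2_field kappa c))
    (extend0 (conf_space kappa c) (S3_field kappa c)).
Proof.
split; first exact: rolling_S1_S2.
set U := conf_space kappa c; set b := flat_fields kappa c.
have ext0 (X Y : 'rV[R]_5 -> 'rV[R]_5) : (forall p, U p -> X p = Y p) ->
    extend0 U X = extend0 U Y.
  move=> XY; apply/funext => p; rewrite /extend0 /patch.
  by case: ifPn => // /set_mem/XY.
have -> : extend0 U (S1_field kappa c) = b`_0 by exact/ext0/S1_fieldE.
have -> : extend0 U (S2_field kappa c) = b`_1 by exact/ext0/S2_fieldE.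
have -> : extend0 U (S3_field kappa c) = b`_2 by exact/ext0/S3_fieldE.
have bsz : size b = 14%N by [].
have btab : has_g2_brackets (@vbracket R) b by exact: flat_fields_brackets.
have bU : lspan b `<=` vector_fields U.
  apply: (lspan_sub bsz (vector_fields_closed (@conf_space_open R kappa c))).
  exact: flat_fields_smooth.
have bbil : bilinear_on (@vbracket R) (lspan b).
  move=> a X Y Z /bU vX /bU vY /bU vZ.
  exact: (vbracket_bilinear (@conf_space_open R kappa c)).
have bind : lin_indep b by apply: (g2_lin_indep bsz bbil btab); exact: flat_fields_neq0.
pose d := @g2_derivations R.
have dsz : size d = 14%N by [].
have dtab : has_g2_brackets (@commutator R _) d by exact: g2_derivations_brackets.
have dbil : bilinear_on (@commutator R _) (lspan d).
  by move=> a f g h _ _ _; exact: commutator_bilinear.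
have dind : lin_indep d.
  apply: (g2_lin_indep dsz dbil dtab); apply/eqP => d0.
  (* This entry of the derivation [L1] is 6. *)
  have : oct_entry d`_8 2 7 = 0 by rewrite d0 /oct_entry zero_lfunE oct_coord0.
  by rewrite g2_derivations_nth // oct_entry_der // => /eqP; rewrite zr_eq0.
have iso : lie_isomorphic (@vbracket R) (lspan b) (@commutator R _) (@split_g2 R).
  by rewrite -split_g2_span; exact: g2_isomorphic.
have lie : is_lie_algebra (@vbracket R) (lspan b).
  apply: (lie_algebra_transport (lspan_closed b) bbil _ (@split_g2_lie R) iso).
  exact: g2_lspan_br.
have x0 : 4^-1 != 0 :> R by rewrite invr_eq0 pnatr_eq0.
have y0 : Num.sqrt 3 / 12 != 0 :> R.
  by rewrite mulf_neq0 ?invr_eq0 ?pnatr_eq0 // gt_eqF // sqrtr_gt0 ltr0n.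
(* Taking the list as an argument lets the entries reduce to the required brackets once [b] is
   written as [g2_gens] of its first three fields. *)
pose B (s : seq ('rV[R]_5 -> 'rV[R]_5)) :=
  [:: s`_0; s`_1; s`_2; s`_3; s`_4; s`_5; 4^-1 *: (s`_7 - s`_6);
      (Num.sqrt 3 / 12) *: (s`_6 + s`_7); s`_8; s`_9; s`_10; s`_11; s`_12; s`_13].
pose T (s : seq ('rV[R]_5 -> 'rV[R]_5)) :=
  [:: 4^-1 *: (s`_7 - s`_6); (Num.sqrt 3 / 12) *: (s`_6 + s`_7)].
have : [/\ lin_indep (B b), lspan (B b) `<=` vector_fields U,
    is_lie_algebra (@vbracket R) (lspan (B b)),
    lie_isomorphic (@vbracket R) (lspan (B b)) (@commutator R _) (@split_g2 R)
  & cartan_subalgebra (@vbracket R) (lspan (B b)) (lspan (T b))].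
  have spanE : lspan (B b) = lspan b by exact: lspan_cartan_basis.
  have cartanE : lspan (T b) = lspan [:: b`_6; b`_7] by exact: lspan_cartan.
  rewrite spanE cartanE; split=> //; first exact: lin_indep_cartan_basis.
  exact: (g2_cartan bsz bbil btab bind).
have E := g2_gens_brackets bsz btab; clearbody b.
by rewrite -E.
Qed.
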